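(* Let $D$ be a northwest diagram and $r$ a row index such that every cell of $D$ in row $r$ has a cell of $D$ directly below it in row $r+1$. Then for every $T\in\mathrm{KD}(D)$ with $f_r(T)\neq 0$ we have $f_r(T)\in\mathrm{KD}(D)$. In particular $\mathfrak{D}_r(\mathrm{KD}(D))=\mathrm{KD}(D)$.
   Context: A diagram is a finite set of cells $(i,j)\in\mathbb{Z}_{>0}^2$ ($i$ row, $j$ column), rows numbered top to bottom. $D$ is northwest if whenever $(j,k),(i,l)\in D$ with $i<j$, $k<l$, then $(i,k)\in D$. A Kohnert move selects the rightmost cell of some row and moves it up (toward row 1) within its column to the first empty position above it, jumping over occupied positions, if one exists; $\mathrm{KD}(D)$ is the set of diagrams reachable from $D$ by sequences of Kohnert moves (including $D$). Kohnert crystal operators: for a diagram $T$ and $i\ge1$, $i$-pair cells of $T$ in rows $i,i+1$ iteratively by pairing an unpaired cell in row $i+1$ with an unpaired cell in row $i$ weakly to its left whenever all cells in rows $i,i+1$ lying (in columns) between them are already $i$-paired. The raising operator $e_i(T)$ is $0$ if all cells of row $i+1$ are $i$-paired, and otherwise moves the rightmost unpaired cell of row $i+1$ to row $i$ (same column). The lowering operator $f_i(T)$ is $0$ if all cells of row $i$ are $i$-paired, and otherwise moves the leftmost unpaired cell of row $i$ to row $i+1$. For a set $X$ of diagrams, $\mathfrak{D}_i(X)=\{U \text{ a diagram}: e_i^k(U)\in X\text{ for some }k\ge0\}$. *)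

(* Defs.v *)
From Stdlib Require Import Relation_Operators.
From mathcomp Require Import all_boot finmap.
From mathcomp Require Import classical_sets.

Set Implicit Arguments.
Unset Strict Implicit.
Unset Printing Implicit Defensive.

Local Open Scope classical_set_scope.
Local Open Scope fset_scope.

(* [(i, j)] is the cell in row [i] and column [j].  Rows and columns are
   numbered from 1, row 1 at the top: this is enforced by [is_diagram]. *)
Definition cell := (nat * nat)%type.
Definition cells := {fset cell}.

Definition is_diagram (D : cells) : Prop :=
  forall c : cell, c \in D -> 0 < c.1 /\ 0 < c.2.

Definition northwest (D : cells) : Prop :=
  forall i j k l : nat,
    (j, k) \in D -> (i, l) \in D -> i < j -> k < l -> (i, k) \in D.

Definition move_cell (T : cells) (x y : cell) : cells := y |` (T `\ x).

Definition kohnert_move (T U : cells) : Prop :=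
  exists r s c : nat,
    [/\ (r, c) \in T /\ (forall c', c < c' -> (r, c') \notin T),
        0 < s < r,
        (s, c) \notin T,
        (forall t, s < t < r -> (t, c) \in T)
      & U = move_cell T (r, c) (s, c)].

Definition KD (D : cells) : set cells :=
  [set T | clos_refl_trans cells kohnert_move D T].

(* [P] is the set of the cells that are already paired and [p = (u, v)], with
   [u] in row [i] and [v] in row [i + 1].  "Between" is meant weakly: the cells
   in the columns of [u] and [v] count as well, so that two cells of the same
   column are always paired with each other. *)
Definition pairable (T : cells) (i : nat) (P : cells) (p : cell * cell) : bool :=
  let: (u, v) := p in
  [&& u.1 == i, v.1 == i.+1, u \notin P, v \notin P, u.2 <= v.2
    & all (fun x : cell =>
             (x.1 \in [:: i; i.+1]) && (u.2 <= x.2 <= v.2)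
             ==> (x \in P) || (x \in [:: u; v])) T].

Definition pair_step (T : cells) (i : nat) (P : cells) : cells :=
  if ohead [seq p <- [seq (u, v) | u <- T, v <- T] | pairable T i P p]
    is Some (u, v) then u |` (v |` P) else P.

(* Each effective step pairs two cells of [T], so the iteration has stopped
   after [#|` T|] steps; the resulting set does not depend on the order in which
   the pairable cells are picked. *)
Definition paired (T : cells) (i : nat) : cells :=
  iter #|` T| (pair_step T i) fset0.

(* Columns of the unpaired cells of row [s], in increasing order. *)
Definition unpaired_cols (T : cells) (i s : nat) : seq nat :=
  sort leq [seq x.2 | x <- T & (x.1 == s) && (x \notin paired T i)].

(* The value 0 of the crystal operators is [None]. *)
Definition raising (i : nat) (T : cells) : option cells :=
  if unpaired_cols T i i.+1 is c :: s
  then Some (move_cell T (i.+1, last c s) (i, last c s)) else None.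

Definition lowering (i : nat) (T : cells) : option cells :=
  if unpaired_cols T i i is c :: s
  then Some (move_cell T (i, c) (i.+1, c)) else None.

Definition frakD (i : nat) (X : set cells) : set cells :=
  [set U | is_diagram U /\
     exists k : nat, exists2 V : cells,
       iter k (obind (raising i)) (Some U) = Some V & X V].

(* Main.v *)
(* Regard the rows of D as reservoirs of letters (the columns), row i receiving
   letters from row i + 1 and sending letters to row i - 1. A Kohnert move
   takes the largest letter out of a row and sends it upwards; a row which
   already contains the letter passes it on, and the first row which does not
   keeps it. For a row S and a word z there is a canonical word rho S z which,
   fed to S, makes it emit z and become empty, whenever this is possible. Let
   A_i be the decreasing word of row i of T, and start with the empty demand
   v_0; then T belongs to KD(D) iff the demands v_i = rho D_i (v_(i-1) A_i) are
   all defined and the last one is empty. The maps rho S preserve a rewriting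
   relation on words, provided that the letters satisfy a condition expressing
   that D is northwest. The operator f_r and the inverse of e_r change the word
   A_r A_(r+1) along this relation, and if D_r is contained in D_(r+1), then
   rho P (v A B) and rho P (v A) B are related in both directions, so that the
   demand of row r + 1 is changed along the relation as well. *)
From Stdlib Require Import Relation_Operators Operators_Properties.
Require Import Defs.
From mathcomp Require Import all_boot finmap.
From mathcomp Require Import classical_sets.
From mathcomp Require Import zify.

Set Implicit Arguments.
Unset Strict Implicit.
Unset Printing Implicit Defensive.

(** * Rewriting words *)

Ltac nlia :=
  simpl in *;
  repeat match goal with
  | H : ?T |- _ =>
    lazymatch T with
    | is_true (leq _ _) => fail
    | nat => fail
    | @eq nat _ _ => fail
    | _ => clear H
    end
  end; lia.

Notation word := (seq nat).

Definition col (s : word) : bool := pairwise gtn s.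

Arguments col : simpl never.

(* These rules are weaker than the Knuth relations [xyc -> yxc], [cxy -> cyx]:
   a letter jumps over a whole column.  The map [rho S] below, which reads a
   word through a row [S], does not preserve the relation generated by the
   Knuth rules, but it preserves this one. *)
Inductive lew : word -> word -> Prop :=
| lew_refl w : lew w w
| lew_trans v u w : lew u v -> lew v w -> lew u w
| lew_cat u u' v v' : lew u u' -> lew v v' -> lew (u ++ v) (u' ++ v')
| lew_swap a b : a < b -> lew [:: a; b] [:: b; a]
| lew_jumpr x Q c : col Q -> all (gtn c) Q || (Q == [:: c]) -> c < x ->
    lew (x :: Q ++ [:: c]) (Q ++ [:: x; c])
| lew_jumpl c x Q : col Q -> all (gtn c) Q -> c <= x ->
    lew (c :: x :: Q) (c :: Q ++ [:: x]).

Lemma lew_catl u v v' : lew v v' -> lew (u ++ v) (u ++ v').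
Proof. by move=> h; apply: lew_cat => //; apply: lew_refl. Qed.

Lemma lew_catr v u u' : lew u u' -> lew (u ++ v) (u' ++ v).
Proof. by move=> h; apply: lew_cat => //; apply: lew_refl. Qed.

Lemma lew_cons a v v' : lew v v' -> lew (a :: v) (a :: v').
Proof. exact: (@lew_catl [:: a]). Qed.

Lemma lew_perm u v : lew u v -> perm_eq u v.
Proof.
elim=> {u v} //=.
- by move=> v u w _ uv _; apply: perm_trans.
- by move=> u u' v v' _ h _; apply: perm_cat.
- by move=> a b _; rewrite (perm_catC [:: a] [:: b]).
- by move=> x Q c _ _ _; rewrite -cat_cons -cat1s -catA perm_catCA.
- by move=> c x Q _ _ _; rewrite perm_cons -cat1s perm_catC.
Qed.

Lemma colE a s : col (a :: s) = all (gtn a) s && col s.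
Proof. by []. Qed.

Lemma col_cat s t : col (s ++ t) = [&& allrel gtn s t, col s & col t].
Proof. exact: pairwise_cat. Qed.

Lemma lew_move a V W : all (ltn a) V -> lew (a :: V ++ W) (V ++ a :: W).
Proof.
elim: V => [|b V IH] /=; first by move=> _; apply: lew_refl.
case/andP=> ab aV; apply: (@lew_trans (b :: a :: V ++ W)).
  exact: (@lew_catr _ [:: a; b] [:: b; a] (lew_swap ab)).
by apply: lew_cons; apply: IH.
Qed.

Lemma lew_swaps U V W : allrel ltn U V -> lew (U ++ V ++ W) (V ++ U ++ W).
Proof.
elim: U => [|a U IH] /=; first by move=> _; apply: lew_refl.
rewrite allrel_consl => /andP[aV UV].
apply: (@lew_trans (a :: V ++ U ++ W)); first by apply: lew_cons; apply: IH.
exact: lew_move.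
Qed.

Lemma lew_back a V W : all (gtn a) V -> lew (V ++ a :: W) (a :: V ++ W).
Proof.
move=> h; apply: (@lew_swaps V [:: a]).
by rewrite allrel1r; apply: sub_all h => x.
Qed.

Lemma lew_jumprs D Q c W : col D -> all (ltn c) D -> col Q ->
  all (gtn c) Q || (Q == [:: c]) ->
  lew (D ++ Q ++ c :: W) (Q ++ D ++ c :: W).
Proof.
move=> + + colQ Qc; elim: D => [|d D IH] /=; first by move=> *; apply: lew_refl.
case/andP=> dD colD /andP[cd cD].
apply: (@lew_trans (d :: Q ++ D ++ c :: W)).
  by apply: lew_cons; apply: IH.
suff [e [V [-> Qe ed]]] : exists e V, [/\ D ++ c :: W = e :: V,
    all (gtn e) Q || (Q == [:: e]) & e < d].
  have := @lew_catr V _ _ (@lew_jumpr d Q e colQ Qe ed).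
  by rewrite /= -!catA.
case: D dD cD {IH colD} => [|e D] /=; first by exists c, W.
case/andP=> ed _ /andP[ce _]; exists e, (D ++ c :: W); split=> //.
apply/orP; left; case/orP: Qc => [Qc|/eqP->] /=; last by rewrite ce.
by apply: sub_all Qc => x /=; lia.
Qed.

(* The reason for allowing arbitrary columns [Q] in the rules. *)
Lemma lew_fall q G F W : col G -> col F -> all (gtn q) F -> all (ltn q) G ->
  lew (q :: G ++ F ++ W) (q :: F ++ G ++ W).
Proof.
move=> + colF Fq; elim: G W => [|g [|e G] IH] W; first by move=> *; apply: lew_refl.
  move=> _ /andP[qg _].
  have := @lew_catr W _ _ (@lew_jumpl q g F colF Fq (ltnW qg)).
  by rewrite /= -!catA.
rewrite colE => /andP[/andP[eg gG] colG] /andP[qg qG].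
apply: (@lew_trans (g :: q :: (e :: G) ++ F ++ W)).
  exact: (@lew_catr _ [:: q; g] [:: g; q] (lew_swap qg)).
apply: (@lew_trans (g :: q :: F ++ (e :: G) ++ W)).
  by apply: lew_cons; apply: IH.
have Fe : all (gtn e) (q :: F).
  by case/andP: qG => qe _; apply/andP; split=> //; apply: sub_all Fq => x /=; move: qe => /=; lia.
have colqF : col (q :: F) by rewrite colE Fq.
have := @lew_catr (G ++ W) _ _ (@lew_jumpr g (q :: F) e colqF _ eg).
by rewrite Fe /= -!catA; apply.
Qed.

Lemma mem_splitP (q : nat) (D : word) : q \in D -> exists D1 D2, D = D1 ++ q :: D2.
Proof. by case/splitPr=> D1 D2; exists D1, D2. Qed.

Lemma col_mid D1 q D2 : col (D1 ++ q :: D2) ->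
  [/\ col D1, col D2, all (ltn q) D1, all (gtn q) D2 & allrel gtn D1 D2].
Proof.
by rewrite col_cat allrel_consr colE => /and3P[/andP[? ?] ? /andP[? ?]].
Qed.

Lemma lew_passl D q W : col D -> q \in D -> lew (D ++ q :: W) (q :: D ++ W).
Proof.
move=> colD /mem_splitP[D1 [D2 eD]]; subst D; have [c1 c2 q1 q2 _] := col_mid colD.
apply: (@lew_trans (D1 ++ [:: q] ++ q :: D2 ++ W)).
  rewrite -catA; apply: lew_catl; apply: lew_cons; exact: lew_back.
rewrite -!catA /=; apply: (@lew_jumprs D1 [:: q] q) => //=.
by rewrite eqxx orbT.
Qed.

Lemma lew_passr D q W : col D -> q \in D -> lew (q :: D ++ W) (D ++ q :: W).
Proof.
move=> colD /mem_splitP[D1 [D2 eD]]; subst D; have [c1 c2 q1 q2 _] := col_mid colD.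
apply: (@lew_trans (D1 ++ q :: q :: D2 ++ W)).
  by rewrite -catA; apply: lew_move.
rewrite -!catA /=; apply: lew_catl.
have := @lew_catr W _ _ (@lew_jumpl q q D2 c2 q2 (leqnn _)).
by rewrite /= -!catA.
Qed.

Lemma lew_after D q F W : col D -> has (geq q) D -> col F -> allrel ltn F D ->
  lew (D ++ q :: F ++ W) (D ++ F ++ q :: W).
Proof.
case/lastP: D => // D c.
rewrite -cats1 col_cat allrel1r => /and3P[cD _ _] + colF.
rewrite allrel_catr allrel1r => cq /andP[_ Fc].
have {}cq : c <= q.
  move: cq; rewrite has_cat /= orbF => /orP[/hasP[d dD /= dq]|//].
  by move/allP: cD => /(_ d dD) /=; lia.
rewrite -!catA /=; apply: lew_catl.
have := @lew_catr W _ _ (@lew_jumpl c q F colF Fc cq).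
by rewrite /= -!catA.
Qed.

Definition hi (q : nat) (C : word) : word := [seq y <- C | q < y].
Definition lo (q : nat) (C : word) : word := [seq y <- C | y < q].
Definition up (q : nat) (C : word) : word := [seq y <- C | q <= y].

Lemma mem_hi q C x : (x \in hi q C) = (q < x) && (x \in C).
Proof. exact: mem_filter. Qed.

Lemma mem_lo q C x : (x \in lo q C) = (x < q) && (x \in C).
Proof. exact: mem_filter. Qed.

Lemma mem_up q C x : (x \in up q C) = (q <= x) && (x \in C).
Proof. exact: mem_filter. Qed.

Definition memE := (mem_hi, mem_lo, mem_up, mem_cat, in_cons, in_nil).

Lemma col_filter (p : pred nat) C : col C -> col (filter p C).
Proof. exact: subseq_pairwise (filter_subseq p C). Qed.

Lemma gtn_rev_trans : transitive gtn.
Proof. by move=> y x z /=; lia. Qed.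

Lemma col_eq s t : col s -> col t -> s =i t -> s = t.
Proof.
rewrite /col -!sorted_pairwise; try exact: gtn_rev_trans.
by apply: irr_sorted_eq; [exact: gtn_rev_trans | move=> x /=; lia].
Qed.

Lemma col_uniq s : col s -> uniq s.
Proof. by apply: pairwise_uniq => x /=; lia. Qed.

Lemma allrel_memP (r : rel nat) (s t : word) :
  (forall x y, x \in s -> y \in t -> r x y) -> allrel r s t.
Proof. by move=> h; apply/allrelP. Qed.

Lemma col_up_lo b C : col C -> C = up b C ++ lo b C.
Proof.
move=> cC; apply: col_eq => // [|x]; last by rewrite !memE; case: (x \in C); lia.
rewrite col_cat !col_filter // !andbT; apply: allrel_memP => x y.
by rewrite !memE /=; lia.
Qed.

Lemma col_hi_lo q C : col C -> q \notin C -> C = hi q C ++ lo q C.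
Proof.
move=> cC qC; rewrite {1}(col_up_lo q cC); congr (_ ++ _).
apply: eq_in_filter => x xC; rewrite ltn_neqAle; case: eqP => // qx.
by rewrite -qx (negPf qC) in xC *.
Qed.

Lemma col_hi_mid_lo q C : col C -> q \in C -> C = hi q C ++ q :: lo q C.
Proof.
move=> cC qC; apply: col_eq => // [|x]; last first.
  by rewrite !memE; case: (x =P q) => [->|]; rewrite ?qC ?orbT //; lia.
rewrite col_cat allrel_consr colE !col_filter // !andbT.
apply/and3P; split; first apply/andP; try split.
- by apply/allP=> x; rewrite !memE => /andP[].
- by apply: allrel_memP => x y; rewrite !memE /=; lia.
- by apply/allP=> x; rewrite !memE => /andP[].
Qed.

(** * Reading a word through a row *)

(* A pair [(C, e)] stands for a row holding the cells [C] that is about to be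
   fed the word [e] from below.  [read p z] finds, going through [z] from right
   to left, the state from which the row emits [z] and ends in state [p]: a
   letter [q] of [C] was passed through, while a new letter [q] was emitted as
   the largest one, after which the letters of [C] above [q] came in. *)
Definition bump (q : nat) (p : word * word) : word * word :=
  if q \in p.1 then (p.1, q :: p.2) else (q :: lo q p.1, hi q p.1 ++ p.2).

Definition read (p : word * word) (z : word) : word * word := foldr bump p z.

(* In a northwest diagram, all the letters found in the rows below a row [S]
   satisfy this condition. *)
Definition ok (S : word) (q : nat) : bool := (q \in S) || all (gtn q) S.

Definition valid (S : word) (p : word * word) : bool := col p.1 && all (ok S) p.1.

Lemma read_cat p u v : read p (u ++ v) = read (read p v) u.
Proof. exact: foldr_cat. Qed.

Lemma bump_col q p : col p.1 -> col (bump q p).1.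
Proof.
rewrite /bump; case: ifP => //= _ c; rewrite colE col_filter // andbT.
by apply/allP=> x; rewrite !memE => /andP[].
Qed.

Lemma bump_valid S q p : valid S p -> ok S q -> valid S (bump q p).
Proof.
case/andP=> c a okq; rewrite /valid bump_col //= /bump; case: ifP => //= _.
by rewrite okq; apply/allP=> x; rewrite !memE => /andP[_ /(allP a)].
Qed.

Lemma read_valid S z p : valid S p -> all (ok S) z -> valid S (read p z).
Proof. by move=> v; elim: z => //= q z IH /andP[? ?]; apply: bump_valid; auto. Qed.

Lemma bump_tail q C e w :
  bump q (C, e ++ w) = ((bump q (C, e)).1, (bump q (C, e)).2 ++ w).
Proof. by rewrite /bump /=; case: ifP => //= _; rewrite catA. Qed.

Lemma read_tail C e w z :
  read (C, e ++ w) z = ((read (C, e) z).1, (read (C, e) z).2 ++ w).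
Proof.
by elim: z => //= q z ->; rewrite -bump_tail; case: (read _ _).
Qed.

Lemma bump_lew q p : col p.1 -> lew (q :: p.1 ++ p.2) ((bump q p).1 ++ (bump q p).2).
Proof.
move=> c; rewrite /bump; case: ifPn => /= qC; first exact: lew_passr.
rewrite {1}(col_hi_lo c qC) -catA; apply: lew_fall; rewrite ?col_filter //.
  by apply/allP=> x; rewrite !memE => /andP[].
by apply/allP=> x; rewrite !memE => /andP[].
Qed.

Lemma read_lew z p : col p.1 ->
  lew (z ++ p.1 ++ p.2) ((read p z).1 ++ (read p z).2).
Proof.
move=> c; elim: z => [|q z IH] /=; first exact: lew_refl.
apply: lew_trans (lew_cons q IH) _; apply: bump_lew.
by elim: (z) => //= *; apply: bump_col.
Qed.

Lemma read_perm z p : col p.1 ->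
  perm_eq (z ++ p.1 ++ p.2) ((read p z).1 ++ (read p z).2).
Proof. by move=> c; apply/lew_perm/read_lew. Qed.

(* The states differ only in the letters [>= b] and in their inputs, and remain
   comparable when the small letters [F] move up past the large ones. *)
Definition sim (S : word) (b : nat) (p p' : word * word) : Prop :=
  lo b p.1 = lo b p'.1 /\
  forall F, col F -> all (gtn b) F -> all (ok S) F ->
    lew (up b p.1 ++ F ++ p.2) (up b p'.1 ++ F ++ p'.2).

Lemma col_up_small b C F : col C -> col F -> all (gtn b) F -> col (up b C ++ F).
Proof.
move=> cC cF Fb; rewrite col_cat cF col_filter // !andbT.
by apply: allrel_memP => x y; rewrite !memE => /andP[bx _] /(allP Fb) /=; nlia.
Qed.

Lemma sim_pass S b q p p' : col p.1 -> col p'.1 -> ok S q -> q < b ->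
  q \in p.1 -> q \in p'.1 -> sim S b p p' -> sim S b (bump q p) (bump q p').
Proof.
move=> c c' okq qb qC qC' [eqlo h]; rewrite /sim /bump qC qC' /=; split=> //.
move=> F cF Fb okF.
have [qF|qF] := boolP (q \in F).
  have [F1 [F2 eF]] := mem_splitP qF; subst F.
  have [cF1 cF2 qF1 qF2 F12] := col_mid cF.
  have Fb1 : all (gtn b) F1 by move: Fb; rewrite all_cat => /andP[].
  have [cD cD'] := (col_up_small c cF1 Fb1, col_up_small c' cF1 Fb1).
  apply: (@lew_trans ((up b p.1 ++ F1) ++ [:: q] ++ q :: F2 ++ p.2)).
    rewrite -!catA /=; do 2!apply: lew_catl; apply: lew_cons; exact: lew_back.
  apply: (@lew_trans ([:: q] ++ (up b p.1 ++ F1) ++ q :: F2 ++ p.2)).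
    apply: lew_jumprs; rewrite ?eqxx ?orbT // all_cat qF1 andbT.
    by apply/allP=> x; rewrite !memE => /andP[? _] /=; nlia.
  apply: (@lew_trans (q :: up b p'.1 ++ (F1 ++ q :: F2) ++ p'.2)).
    by rewrite /= -!catA; apply: lew_cons; have := h _ cF Fb okF; rewrite -!catA.
  apply: (@lew_trans ((up b p'.1 ++ F1) ++ q :: q :: F2 ++ p'.2)).
    rewrite -!catA /=.
    have := @lew_move q (up b p'.1 ++ F1) (q :: F2 ++ p'.2).
    rewrite -!catA /=; apply; rewrite all_cat qF1 andbT.
    by apply/allP=> x; rewrite !memE => /andP[? _] /=; nlia.
  rewrite -!catA /=; do 2!apply: lew_catl.
  have := @lew_catr p'.2 _ _ (@lew_jumpl q q F2 cF2 qF2 (leqnn _)).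
  by rewrite /= -!catA.
have eF := col_hi_lo cF qF.
have Fb1 : all (gtn b) (hi q F).
  by apply/allP=> x; rewrite !memE => /andP[_ /(allP Fb)].
have cF1 : col (hi q F) by apply: col_filter.
have [cD cD'] := (col_up_small c cF1 Fb1, col_up_small c' cF1 Fb1).
have cF2 : col (lo q F) by apply: col_filter.
apply: (@lew_trans (lo q F ++ (up b p.1 ++ hi q F) ++ q :: p.2)).
  rewrite {1}eF -(catA (hi q F)) (catA (up b p.1)); apply: lew_jumprs => //.
    rewrite all_cat; apply/andP; split; apply/allP=> x; rewrite !memE => /andP[] /=; nlia.
  by apply/orP; left; apply/allP=> x; rewrite !memE => /andP[].
apply: (@lew_trans (lo q F ++ (up b p'.1 ++ hi q F) ++ q :: p'.2)).
  apply: lew_catl; have := h (hi q F ++ [:: q]); rewrite -!catA; apply.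
  - rewrite col_cat cF1 allrel1r !andbT.
    by apply/allP=> x; rewrite !memE => /andP[].
  - by rewrite all_cat Fb1 /= qb.
  - rewrite all_cat /= okq !andbT.
    by apply/allP=> x; rewrite !memE => /andP[_ /(allP okF)].
rewrite {3}eF -(catA (hi q F)) (catA (up b p'.1) (hi q F)).
apply: lew_swaps; apply: allrel_memP => x y.
rewrite !memE => /andP[xq xF] /orP[]/andP[? ?] /=; nlia.
Qed.

Lemma sim_bumpl b q p F : col p.1 -> col F -> all (gtn b) F -> b <= q ->
  lew (up b (bump q p).1 ++ F ++ (bump q p).2) (q :: up b p.1 ++ F ++ p.2).
Proof.
move=> c cF Fb bq; rewrite /bump; case: ifPn => /= qC.
  apply: (@lew_trans (up b p.1 ++ q :: F ++ p.2)).
    apply: lew_catl; apply: lew_back; apply: sub_all Fb => x /=; nlia.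
  by apply: lew_passl; rewrite ?col_filter // !memE bq.
rewrite bq /=; apply: lew_cons.
have -> : up b p.1 = hi q p.1 ++ up b (lo q p.1).
  by rewrite {1}(col_hi_lo c qC) {1}/up filter_cat; congr (_ ++ _);
     apply/all_filterP/allP=> x; rewrite !memE => /andP[? _] /=; nlia.
rewrite -!catA catA (catA (up _ _)); apply: lew_swaps.
apply: allrel_memP => x y; rewrite !memE => /orP[/and3P[_ ? _]|/(allP Fb) /= ?] /andP[? _] /=; nlia.
Qed.

Lemma sim_bumpr b q p F : col p.1 -> col F -> all (gtn b) F -> b <= q ->
  lew (q :: up b p.1 ++ F ++ p.2) (up b (bump q p).1 ++ F ++ (bump q p).2).
Proof.
move=> c cF Fb bq; rewrite /bump; case: ifPn => /= qC.
  have qD : q \in up b p.1 by rewrite !memE bq.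
  apply: (@lew_trans (up b p.1 ++ q :: F ++ p.2)).
    by apply: lew_passr; rewrite ?col_filter.
  apply: lew_after; rewrite ?col_filter //; first by apply/hasP; exists q => /=.
  by apply: allrel_memP => x y /(allP Fb) /= ?; rewrite !memE => /andP[? _] /=; nlia.
rewrite bq /=.
have -> : up b p.1 = hi q p.1 ++ up b (lo q p.1).
  by rewrite {1}(col_hi_lo c qC) {1}/up filter_cat; congr (_ ++ _);
     apply/all_filterP/allP=> x; rewrite !memE => /andP[? _] /=; nlia.
rewrite -!catA (catA (up _ _)) (catA (up _ _)); apply: lew_fall.
- by rewrite col_filter.
- by apply: col_up_small => //; apply: col_filter.
- rewrite all_cat; apply/andP; split; last by apply: sub_all Fb => x /=; nlia.
  by apply/allP=> x; rewrite !memE => /and3P[].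
- by apply/allP=> x; rewrite !memE => /andP[].
Qed.

Lemma lo_bump b q p : b <= q -> lo b (bump q p).1 = lo b p.1.
Proof.
move=> bq; rewrite /bump; case: ifP => //= _.
rewrite ltnNge bq /= /lo -filter_predI; apply: eq_filter => x /=; nlia.
Qed.

Lemma sim_large S b q p p' : col p.1 -> col p'.1 -> b <= q ->
  sim S b p p' -> sim S b (bump q p) (bump q p').
Proof.
move=> c c' bq [eqlo h]; split; first by rewrite !lo_bump.
move=> F cF Fb okF; apply: lew_trans (sim_bumpl c cF Fb bq) _.
apply: lew_trans (sim_bumpr c' cF Fb bq).
by apply: lew_cons; apply: h.
Qed.

Definition srel (S : word) (p p' : word * word) : Prop :=
  (p.1 = p'.1 /\ lew p.2 p'.2) \/
  exists b, [/\ ok S b, b \in S -> b \notin p.1 & sim S b p p'].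

Lemma lo_id b s : all (gtn b) s -> lo b s = s.
Proof. by move=> h; apply/all_filterP. Qed.

Lemma hi_nil b s : all (geq b) s -> hi b s = [::].
Proof.
move=> h; apply/eqP; rewrite -[_ == _]negbK -has_filter; apply/hasPn => x /(allP h) /=.
by rewrite -leqNgt.
Qed.

Lemma up_nil b s : all (gtn b) s -> up b s = [::].
Proof.
move=> h; apply/eqP; rewrite -[_ == _]negbK -has_filter; apply/hasPn => x /(allP h) /=.
by rewrite -ltnNge.
Qed.

Lemma up_id b s : all (leq b) s -> up b s = s.
Proof. by move=> h; apply/all_filterP. Qed.

Lemma all_lo b s : all (gtn b) (lo b s).
Proof. exact: filter_all. Qed.

Lemma all_hi b s : all (ltn b) (hi b s).
Proof. exact: filter_all. Qed.

Lemma lo_lo q b s : q <= b -> lo q (lo b s) = lo q s.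
Proof.
move=> qb; rewrite /lo -filter_predI; apply: eq_filter => x /=; nlia.
Qed.

Lemma up_hi b s : b \notin s -> up b s = hi b s.
Proof.
move=> bs; apply: eq_in_filter => x xs; rewrite leq_eqVlt.
by case: eqP => // e; rewrite -e (negPf bs) in xs *.
Qed.

Lemma hi_split q b s : col s -> q < b -> hi q s = up b s ++ hi q (lo b s).
Proof.
move=> cs qb; rewrite {1}(col_up_lo b cs) {1}/hi filter_cat; congr (_ ++ _).
by apply/all_filterP/allP => x; rewrite !memE => /andP[? _]; nlia.
Qed.

Lemma hi_splitn q b s : col s -> b \notin s -> q < b ->
  hi q s = hi b s ++ hi q (lo b s).
Proof. by move=> cs bs qb; rewrite (hi_split cs qb) up_hi. Qed.

Lemma srel_bump S q p p' : valid S p -> valid S p' -> ok S q ->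
  srel S p p' -> srel S (bump q p) (bump q p').
Proof.
case: p p' => [C X] [C' X'] /andP[/= c _] /andP[/= c' okC'] okq.
case=> [[/= <- XX']|[b [okb bS]]].
  left; rewrite /bump /=; case: ifP => _ /=; split=> //; first exact: lew_cons.
  exact: lew_catl.
move=> sm; have [/= eqlo h] := sm; rewrite /= in bS.
have [qb|bq] := ltnP q b.
  have qCC' : (q \in C) = (q \in C').
    have := mem_lo b C q; rewrite eqlo mem_lo qb /= => ->.
    by [].
  have [qC|qC] := boolP (q \in C).
    right; exists b; split=> //; first by rewrite /bump /= qC.
    by apply: sim_pass => //=; rewrite -qCC'.
  left; rewrite /bump /= -qCC' (negPf qC) /=; split.
    by rewrite -(lo_lo C (ltnW qb)) eqlo lo_lo // ltnW.
  rewrite (hi_split c qb) (hi_split c' qb) eqlo -!catA; apply: h.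
  - by do 2 apply: col_filter.
  - by apply/allP=> x; rewrite !memE => /and3P[].
  - by apply/allP=> x; rewrite !memE => /and3P[_ _ /(allP okC')].
have sm' := sim_large (c : col (C, X).1) (c' : col (C', X').1) bq sm.
have [/andP[bSin /eqP eqb]|nb] := boolP ((b \in S) && (q == b)); last first.
  right; exists b; split=> // bSin; move: nb; rewrite bSin /= => qb.
  rewrite /bump /=; case: ifP => /= _; first exact: bS.
  by rewrite !memE eq_sym (negPf qb) (negPf (bS bSin)) andbF.
subst q; have bC := bS bSin.
have h0 := h [::] isT isT isT; rewrite /= up_hi // in h0.
have [bC'|bC'] := boolP (b \in C'); last first.
  left; rewrite /bump /= (negPf bC) (negPf bC') /= eqlo; split=> //.
  by rewrite up_hi in h0.
have upC' : up b C' = hi b C' ++ [:: b].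
  rewrite {1}(col_hi_mid_lo c' bC') {1}/up filter_cat /= leqnn; congr (_ ++ _ :: _).
    by apply/all_filterP/allP => x; rewrite !memE => /andP[? _]; nlia.
  by apply: up_nil; apply: all_lo.
rewrite upC' -catA /= in h0.
rewrite /bump /= (negPf bC) bC'.
move eqG: (hi b C') => G0; case: (lastP G0) eqG => [|G b2] eG {G0}.
  left; rewrite /= {1}eqlo; rewrite eG in h0; split=> //.
  by rewrite [RHS](col_hi_mid_lo c' bC') eG.
have b2C' : b2 \in hi b C' by rewrite eG mem_rcons mem_head.
move: (b2C'); rewrite mem_hi => /andP[bb2 b2C].
have lob2 : forall s, lo b2 (b :: lo b s) = b :: lo b s.
  move=> s; apply: lo_id; rewrite /= bb2 /=; apply: (sub_all _ (all_lo b s)) => x; nlia.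
have lenG : all (leq b2) (hi b C').
  have := col_filter (ltn b) c'; rewrite -/(hi b C') eG -cats1 col_cat allrel1r.
  case/and3P=> cG _ _; rewrite all_cat /= leqnn /= andbT; apply: sub_all cG => x; nlia.
have loC' : lo b2 C' = b :: lo b C'.
  rewrite {1}(col_hi_mid_lo c' bC') {1}/lo filter_cat -/(lo b2 (b :: lo b C')) lob2.
  suff -> : [seq y <- hi b C' | y < b2] = [::] by [].
  apply/eqP; rewrite -[_ == _]negbK -has_filter; apply/hasPn => x /(allP lenG).
  by rewrite -leqNgt.
right; exists b2; split.
- exact: (allP okC').
- by move=> _ /=; rewrite !memE; apply/negP => /orP[/eqP|/andP[]]; nlia.
- split; first by rewrite [LHS]lob2 [RHS]loC' eqlo.
  move=> F cF Fb2 _ /=; rewrite -/(up b2 (lo b C)) [up b2 (lo b C)]up_nil; last first.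
    by apply: (sub_all _ (all_lo b C)) => x; nlia.
  rewrite leqNgt bb2 /=.
  have -> : up b2 C' = hi b C'.
    rewrite {1}(col_hi_mid_lo c' bC') {1}/up filter_cat /= leqNgt bb2 /=.
    rewrite -/(up b2 (lo b C')) [up b2 (lo b C')]up_nil ?cats0.
      by apply/all_filterP.
    by apply: (sub_all _ (all_lo b C')) => x; nlia.
  apply: lew_trans (lew_catl F h0) _; apply: lew_swaps.
  apply: allrel_memP => x y /(allP Fb2) ? /(allP lenG) ?; nlia.
Qed.

Lemma srel_read S z p p' : valid S p -> valid S p' -> all (ok S) z ->
  srel S p p' -> srel S (read p z) (read p' z).
Proof.
move=> v v'; elim: z => //= q z IH /andP[okq okz] r.
by apply: srel_bump => //; [apply: read_valid | apply: read_valid | apply: IH].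
Qed.

Definition scan (z : word) : word * word := read ([::], [::]) z.

Definition final (S : word) (p : word * word) : word :=
  [seq x <- p.1 | x \notin S] ++ p.2.

Definition has_col (S : word) (p : word * word) : bool := all (mem p.1) S.

Lemma srel_final S p p' : valid S p -> valid S p' -> srel S p p' -> has_col S p ->
  has_col S p' /\ lew (final S p) (final S p').
Proof.
case: p p' => [C X] [C' X'] /andP[/= c _] /andP[/= c' okC'].
case=> [[/= <- XX']|[b [okb bS]]]; first by split=> //; apply: lew_catl.
case=> /= eqlo h /allP SC; rewrite /= in SC bS.
have bnS : b \notin S.
  by apply/negP => bSin; have := bS bSin; rewrite SC.
have Sb : all (gtn b) S by move: okb; rewrite /ok (negPf bnS).
have SC' x : x \in S -> x \in lo b C'.
  by move=> xS; rewrite -eqlo mem_lo SC // andbT; apply: (allP Sb).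
split; first by apply/allP=> x /SC' /=; rewrite mem_lo => /andP[].
have E D : col D -> [seq x <- D | x \notin S] =
    up b D ++ [seq x <- lo b D | x \notin S].
  move=> cD; rewrite {1}(col_up_lo b cD) filter_cat; congr (_ ++ _).
  apply/all_filterP/allP => x; rewrite !memE => /andP[bx _].
  by apply/negP => /(allP Sb); nlia.
rewrite /final /= (E _ c) (E _ c') eqlo -!catA; apply: h.
- by do 2 apply: col_filter.
- by apply/allP=> x; rewrite mem_filter mem_lo => /and3P[].
- by apply/allP=> x; rewrite mem_filter mem_lo => /and3P[_ _ /(allP okC')].
Qed.

Lemma read_sub p Q : all (mem p.1) Q -> read p Q = (p.1, Q ++ p.2).
Proof.
elim: Q => [|q Q IH] /=; first by case: p.
by case/andP=> qC /IH ->; rewrite /bump /= qC.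
Qed.

Lemma read_new p Q1 q Q2 : col (Q1 ++ q :: Q2) -> all (mem p.1) Q2 ->
  q \notin p.1 ->
  read p (Q1 ++ q :: Q2) = (Q1 ++ q :: lo q p.1, hi q p.1 ++ Q2 ++ p.2).
Proof.
move=> + Q2C qC; elim: Q1 => [|a Q1 IH] /=.
  by move=> _; rewrite read_sub // /bump /= (negPf qC).
rewrite colE => /andP[aQ /IH ->].
have aD : all (gtn a) (Q1 ++ q :: lo q p.1).
  move: aQ; rewrite !all_cat /= => /and3P[-> aq _]; rewrite aq /=.
  by apply: (sub_all _ (all_lo q p.1)) => x; nlia.
rewrite /bump /= ifN; last by apply/negP => /(allP aD); nlia.
by rewrite lo_id // hi_nil //; apply: sub_all aD => x; nlia.
Qed.

Lemma col_newP (C Q : word) : all (mem C) Q \/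
  exists Q1 q Q2, [/\ Q = Q1 ++ q :: Q2, all (mem C) Q2 & q \notin C].
Proof.
elim: Q => [|a Q [QC|[Q1 [q [Q2 [-> ? ?]]]]]] /=; first by left.
  have [aC|aC] := boolP (a \in C); first by left.
  by right; exists [::], a, Q.
by right; exists (a :: Q1), q, Q2.
Qed.

Lemma srel_id S C X X' : lew X X' -> srel S (C, X) (C, X').
Proof. by left. Qed.

Lemma bump_in q C X : q \in C -> bump q (C, X) = (C, q :: X).
Proof. by rewrite /bump /= => ->. Qed.

Lemma bump_notin q C X : q \notin C -> bump q (C, X) = (q :: lo q C, hi q C ++ X).
Proof. by rewrite /bump /= => /negPf ->. Qed.

Lemma bump_max q C X : all (gtn q) C -> bump q (C, X) = (q :: C, X).
Proof.
move=> Cq; rewrite bump_notin; last by apply/negP => /(allP Cq); nlia.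
by rewrite lo_id // hi_nil //; apply: sub_all Cq => x; nlia.
Qed.

Lemma up_max b s : all (gtn b) s -> up b (b :: s) = [:: b].
Proof. by move=> sb; rewrite /up /= leqnn -/(up b s) up_nil. Qed.

Lemma srel_swap S a b p : valid S p -> ok S a -> ok S b -> a < b ->
  srel S (read p [:: a; b]) (read p [:: b; a]).
Proof.
case: p => C X /andP[/= c okC] oka okb ab.
have [aC|aC] := boolP (a \in C); have [bC|bC] := boolP (b \in C).
- rewrite !bump_in //; apply: srel_id.
  exact: (@lew_catr X _ _ (lew_swap ab)).
- rewrite [bump b (C, X)]bump_notin // [bump a (C, X)]bump_in //.
  rewrite [bump b _]bump_notin // bump_in; last by rewrite !memE ab aC orbT.
  apply: srel_id; apply: lew_move.
  by apply/allP=> x; rewrite !memE => /andP[]; nlia.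
- rewrite [bump b (C, X)]bump_in // [bump a _]bump_notin // [bump a _]bump_notin //.
  have Db : all (gtn b) (a :: lo a C).
    by rewrite /= ab; apply: (sub_all _ (all_lo a C)) => x; nlia.
  rewrite bump_max //; right; exists b; split=> //=.
    by move=> _; apply/negP => /(allP Db); nlia.
  have lob : lo b (b :: a :: lo a C) = lo b (a :: lo a C) by rewrite /= ltnn.
  split; first exact: esym lob.
  move=> F cF Fb _; rewrite [up b (_ :: _)]up_nil //.
  rewrite up_max //.
  rewrite /=; apply: (@lew_trans (F ++ b :: hi a C ++ X)).
    apply: lew_catl; apply: lew_passl; first exact: col_filter.
    by rewrite mem_hi ab.
  exact: lew_back.
- rewrite [bump b (C, X)]bump_notin // [bump a (C, X)]bump_notin //.
  have Db : all (gtn b) (a :: lo a C).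
    by rewrite /= ab; apply: (sub_all _ (all_lo a C)) => x; nlia.
  rewrite [bump b _]bump_max // bump_notin; last first.
    by rewrite !memE (negPf aC) andbF orbF; apply/negP => /eqP; nlia.
  rewrite /= ab ltnNge (ltnW ab) /= lo_lo ?(ltnW ab) //.
  right; exists b; split=> //=; first by move=> _; apply/negP => /(allP Db); nlia.
  have lob : lo b (b :: a :: lo a C) = lo b (a :: lo a C) by rewrite /= ltnn.
  split; first exact: esym lob.
  move=> F cF Fb _; rewrite [up b (_ :: _)]up_nil //.
  rewrite up_max //.
  rewrite /= (hi_splitn c bC ab) -!catA.
  apply: (@lew_trans (b :: F ++ hi a (lo b C) ++ hi b C ++ X)); first exact: lew_back.
  apply: lew_cons; apply: lew_catl; apply: lew_swaps.
  by apply: allrel_memP => x y; rewrite !memE => /and3P[_ ? _] /andP[? _]; nlia.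
Qed.

Lemma lew_fall_after D G F W : col D -> col G -> col F ->
  has (fun d => all (ltn d) G) D -> allrel ltn F D ->
  lew (D ++ G ++ F ++ W) (D ++ F ++ G ++ W).
Proof.
case/lastP: D => // D d; rewrite -cats1 col_cat allrel1r.
case/and3P=> cD _ _ cG cF hasd; rewrite allrel_catr allrel1r => /andP[_ Fd].
rewrite -!catA /=; apply: lew_catl; apply: lew_fall => //.
move: hasd; rewrite has_cat /= orbF => /orP[/hasP[e eD eG]|//].
by apply: sub_all eG => x; move/allP: cD => /(_ e eD); nlia.
Qed.

Lemma srel_jumpl S c x Q p : valid S p -> col Q -> all (gtn c) Q -> c <= x ->
  srel S (read p (c :: x :: Q)) (read p (c :: Q ++ [:: x])).
Proof.
case: p => C X /andP[/= cC okC] cQ Qc cx; rewrite read_cat /=.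
have Qx : all (gtn x) Q by apply: sub_all Qc => y; nlia.
have xlo : x \notin C -> all (mem C) Q -> all (mem (x :: lo x C)) Q.
  move=> _ /allP QC; apply/allP => y yQ; have /= yC := QC y yQ.
  by rewrite /= !memE yC; have /= -> := allP Qx y yQ; rewrite orbT.
case: (col_newP C Q) => [QC|[Q1 [q [Q2 [eQ Q2C qC]]]]].
  rewrite (@read_sub (C, X)) //=.
  have [xC|xC] := boolP (x \in C).
    rewrite !(bump_in _ xC) read_sub //=.
    have [cCin|cCn] := boolP (c \in C).
      rewrite !(bump_in _ cCin); apply: srel_id.
      have := @lew_catr X _ _ (@lew_jumpl c x Q cQ Qc cx).
      by rewrite /= -!catA.
    rewrite !(bump_notin _ cCn); apply: srel_id; apply: lew_after => //.
    - exact: col_filter.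
    - apply/hasP; exists x => //=; rewrite mem_hi xC andbT ltn_neqAle cx andbT.
      by apply/eqP => e; rewrite e xC in cCn.
    - apply: allrel_memP => y z /(allP Qc) ?; rewrite mem_hi => /andP[? _]; nlia.
  rewrite !(bump_notin _ xC) read_sub ?xlo //=.
  have chi : col (hi x C) by apply: col_filter.
  have xhi := all_hi x C.
  have [cD|cD] := boolP (c \in x :: lo x C).
    rewrite !(bump_in _ cD); apply: srel_id; apply: lew_fall => //.
    by apply: sub_all xhi => y; nlia.
  rewrite !(bump_notin _ cD); apply: srel_id; apply: lew_fall_after => //.
  - apply: col_filter; rewrite colE all_lo; exact: col_filter.
  - apply/hasP; exists x => //; rewrite mem_hi mem_head andbT ltn_neqAle cx andbT.
    by apply/eqP => e; rewrite e mem_head in cD.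
  - by apply: allrel_memP => y z /(allP Qc) ?; rewrite mem_hi => /andP[? _]; nlia.
have [qc q2 c1 c2] : [/\ q < c, all (gtn q) Q2, all (gtn c) Q1 & all (gtn c) Q2].
  move: Qc; rewrite eQ all_cat /= => /and3P[-> -> ->].
  by move: cQ; rewrite eQ => /col_mid[].
have colQ2 : col Q2 by move: cQ; rewrite eQ => /col_mid[].
set D1 := Q1 ++ q :: lo q C.
have D1c : all (gtn c) D1.
  rewrite all_cat c1 /= qc; apply: (sub_all _ (all_lo q C)) => y; nlia.
have D1x : all (gtn x) D1 by apply: sub_all D1c => y; nlia.
have -> : bump c (bump x (read (C, X) Q)) = (c :: D1, x :: hi q C ++ Q2 ++ X).
  rewrite eQ read_new -?eQ //= -/D1 bump_max //.
  move: cx; rewrite leq_eqVlt => /orP[/eqP e|cx].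
    by rewrite -e bump_in ?mem_head.
  rewrite bump_notin; last by apply/negP => /orP[/eqP|/(allP D1c)]; nlia.
  rewrite /= cx ltnNge (ltnW cx) /= -/(lo c D1) -/(hi c D1) lo_id // hi_nil //.
  by apply: sub_all D1c => y; nlia.
have [xC|xC] := boolP (x \in C).
  rewrite bump_in // eQ read_new -?eQ //= -/D1 bump_max //; apply: srel_id.
  have chi : col (hi q C) by apply: col_filter.
  have xhi : x \in hi q C by rewrite mem_hi xC andbT; nlia.
  apply: (@lew_trans (hi q C ++ x :: Q2 ++ X)); first exact: lew_passr.
  apply: lew_after => //; first by apply/hasP; exists x => /=.
  by apply: allrel_memP => y z /(allP q2) ?; rewrite mem_hi => /andP[? _]; nlia.
have Q2x : all (mem (x :: lo x C)) Q2.
  apply/allP => y yQ; rewrite /= !memE.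
  have /= -> := allP Q2C y yQ; have := allP c2 y yQ; nlia.
have qx : q < x by nlia.
rewrite bump_notin // eQ read_new -?eQ //; last first.
  by rewrite !memE (negPf qC) andbF orbF; apply/negP => /eqP; nlia.
rewrite /= qx (ltnNge x) (ltnW qx) /= lo_lo ?(ltnW qx) // -/D1 bump_max //.
apply: srel_id; rewrite (hi_splitn cC xC qx) -/(hi q (lo x C)) -!catA.
rewrite (catA (hi q (lo x C))) (catA (hi q (lo x C))).
apply: lew_fall.
- exact: col_filter.
- rewrite col_cat colQ2 andbT; apply/andP; split; last by do 2 apply: col_filter.
  by apply: allrel_memP => y z; rewrite mem_hi => /andP[? _] /(allP q2); nlia.
- rewrite all_cat; apply/andP; split; last by apply: sub_all q2 => y; nlia.
  by apply/allP => y; rewrite !memE => /and3P[].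
- exact: all_hi.
Qed.

Lemma col_headE c G : col G -> c \in G -> all (geq c) G -> exists G', G = c :: G'.
Proof.
case: G => [|g G] //; rewrite colE => /andP[gG _] cG /andP[/= gc _]; exists G.
congr (_ :: _); move: cG; rewrite inE => /orP[/eqP|/(allP gG)] //; nlia.
Qed.

Lemma srel_jumpr_in S C X x Q c : col C -> all (ok S) C -> ok S c -> c \in C ->
  (exists X0, X = c :: X0) \/ all (geq c) C ->
  col Q -> all (gtn c) Q || (Q == [:: c]) -> c < x ->
  srel S (bump x (read (C, X) Q)) (read (bump x (C, X)) Q).
Proof.
move=> cC okC okc cCin hX cQ Qc cx.
have Qx : all (gtn x) Q.
  case/orP: Qc => [Qc|/eqP->]; last by rewrite /= cx.
  by apply: sub_all Qc => y; nlia.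
case: (col_newP C Q) => [QC|[Q1 [q [Q2 [eQ Q2C qC]]]]].
  rewrite (@read_sub (C, X)) //=.
  have [xC|xC] := boolP (x \in C).
    rewrite !(bump_in _ xC) read_sub //=.
    case: hX => [[X0 ->]|/allP /(_ x xC) /=]; last by nlia.
    by apply: srel_id; have := @lew_catr X0 _ _ (@lew_jumpr x Q c cQ Qc cx);
       rewrite /= -!catA.
  rewrite !(bump_notin _ xC) read_sub /=; last first.
    apply/allP => y yQ; rewrite /= !memE.
    have /= -> := allP QC y yQ; have /= -> := allP Qx y yQ; by rewrite orbT.
  apply: srel_id; case: hX => [[X0 ->]|Cc].
    apply: lew_jumprs => //; first by apply: col_filter.
    by apply: (sub_all _ (all_hi x C)) => y; nlia.
  rewrite hi_nil; first exact: lew_refl.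
  by apply: sub_all Cc => y; nlia.
have {}Qc : all (gtn c) Q.
  case/orP: Qc => // /eqP e; move: eQ; rewrite e.
  by case: Q1 => [[eq _]|? []//]; rewrite -eq cCin in qC.
have [qc q2 c1 c2] : [/\ q < c, all (gtn q) Q2, all (gtn c) Q1 & all (gtn c) Q2].
  move: Qc; rewrite eQ all_cat /= => /and3P[-> -> ->].
  by move: cQ; rewrite eQ => /col_mid[].
have colQ2 : col Q2 by move: cQ; rewrite eQ => /col_mid[].
set D1 := Q1 ++ q :: lo q C.
have D1c : all (gtn c) D1.
  rewrite all_cat c1 /= qc; apply: (sub_all _ (all_lo q C)) => y; nlia.
have D1x : all (gtn x) D1 by apply: sub_all D1c => y; nlia.
rewrite {1}eQ read_new -?eQ //= -/D1 bump_max //.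
have cG : c \in hi q C by rewrite mem_hi qc.
have colG : col (hi q C) by apply: col_filter.
have Q2G : allrel ltn Q2 (hi q C).
  by apply: allrel_memP => y z /(allP q2) ?; rewrite mem_hi => /andP[? _]; nlia.
have lox : lo c (x :: D1) = D1 by rewrite /lo /= ltnNge (ltnW cx) /= -/(lo c D1) lo_id.
have upx : up c (x :: D1) = [:: x] by rewrite /up /= (ltnW cx) -/(up c D1) up_nil.
suff H Y : (forall F, col F -> all (gtn c) F -> all (ok S) F ->
    lew (x :: F ++ hi q C ++ Q2 ++ X) (F ++ Y)) ->
    srel S (x :: D1, hi q C ++ Q2 ++ X) (D1, Y).
  have front F X0 : col F -> all (gtn c) F -> X = c :: X0 ->
      lew (x :: F ++ hi q C ++ Q2 ++ X) (F ++ x :: hi q C ++ Q2 ++ X).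
    move=> cF Fc ->.
    apply: (@lew_trans (x :: F ++ c :: hi q C ++ Q2 ++ X0)).
      apply/lew_cons/lew_catl.
      apply: (@lew_trans (hi q C ++ c :: Q2 ++ X0)).
        by apply: lew_catl; apply: lew_back.
      exact: lew_passl.
    apply: (@lew_trans (F ++ x :: c :: hi q C ++ Q2 ++ X0)).
      have := @lew_catr (hi q C ++ Q2 ++ X0) _ _ (@lew_jumpr x F c cF _ cx).
      by rewrite Fc /= -!catA; apply.
    apply/lew_catl/lew_cons.
    apply: (@lew_trans (hi q C ++ c :: Q2 ++ X0)); first exact: lew_passr.
    by apply: lew_after => //; apply/hasP; exists c => /=.
  have [xC|xC] := boolP (x \in C).
    rewrite bump_in // eQ read_new -?eQ //= -/D1; apply: H => F cF Fc okF.
    case: hX => [[X0 eX]|/allP /(_ x xC) /=]; last by nlia.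
    apply: lew_trans (front F X0 cF Fc eX) _; apply: lew_catl.
    apply: (@lew_trans (hi q C ++ x :: Q2 ++ X)).
      by apply: lew_passr => //; rewrite mem_hi xC andbT; nlia.
    apply: lew_after => //; apply/hasP; exists x => //=.
    by rewrite mem_hi xC andbT; nlia.
  have Q2x : all (mem (x :: lo x C)) Q2.
    apply/allP => y yQ; rewrite /= !memE.
    have /= -> := allP Q2C y yQ; have := allP c2 y yQ; nlia.
  have qx : q < x by nlia.
  rewrite bump_notin // eQ read_new -?eQ //; last first.
    by rewrite !memE (negPf qC) andbF orbF; apply/negP => /eqP; nlia.
  rewrite /= qx (ltnNge x) (ltnW qx) /= lo_lo ?(ltnW qx) // -/D1.
  apply: H => F cF Fc okF; case: hX => [[X0 eX]|Cc].
    apply: lew_trans (front F X0 cF Fc eX) _; apply: lew_catl.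
    rewrite (hi_splitn cC xC qx) -/(hi q (lo x C)) -!catA.
    rewrite (catA (hi q (lo x C))) (catA (hi q (lo x C))).
    apply: lew_fall.
    - exact: col_filter.
    - rewrite col_cat colQ2 andbT; apply/andP; split; last by do 2 apply: col_filter.
      by apply: allrel_memP => y z; rewrite mem_hi => /andP[? _] /(allP q2); nlia.
    - rewrite all_cat; apply/andP; split; last by apply: sub_all q2 => y; nlia.
      by apply/allP => y; rewrite !memE => /and3P[].
    - exact: all_hi.
  rewrite (@hi_nil x C); last by apply: sub_all Cc => y; nlia.
  rewrite (@lo_id x C) -/(hi q C); last by apply: sub_all Cc => y; nlia.
  have [|G' ->] := col_headE colG cG.
    by apply/allP => y; rewrite mem_hi => /andP[_ /(allP Cc)].
  have := @lew_catr (G' ++ Q2 ++ X) _ _ (@lew_jumpr x F c cF _ cx).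
  by rewrite Fc /= -!catA; apply.
move=> h; right; exists c; split=> //=.
  move=> _; rewrite inE negb_or; apply/andP; split.
    by apply/eqP; nlia.
  by apply/negP => /(allP D1c); nlia.
split; first by rewrite [LHS]lox [RHS]lo_id.
by move=> F cF Fc okF; rewrite upx up_nil //; apply: h.
Qed.

Lemma srel_jumpr S p x Q c : valid S p -> ok S c ->
  col Q -> all (gtn c) Q || (Q == [:: c]) -> c < x ->
  srel S (read p (x :: Q ++ [:: c])) (read p (Q ++ [:: x; c])).
Proof.
move=> v okc cQ Qc cx; rewrite -cat_cons !read_cat /=.
have := bump_valid v okc; case e: (bump c p) => [C X] /andP[/= cC okC].
suff [cCin hX] : c \in C /\ ((exists X0, X = c :: X0) \/ all (geq c) C).
  exact: srel_jumpr_in okc cCin hX cQ Qc cx.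
move: e; rewrite /bump; case: ifP => [cp [<- <-]|_ [<- _]].
  by split=> //; left; eexists.
split; first exact: mem_head.
by right; rewrite /= leqnn; apply: (sub_all _ (all_lo c p.1)) => y; nlia.
Qed.

(* The word to be fed to the row [S] in order to make it emit [z] and become
   empty; it is meaningful only if [has_col S (scan z)]. *)
Definition rho (S z : word) : word := final S (scan z).

Lemma valid_nil S X : valid S ([::], X).
Proof. by []. Qed.

Lemma scan_valid S z : all (ok S) z -> valid S (scan z).
Proof. by move=> okz; apply: read_valid. Qed.

Lemma col_scan z : col (scan z).1.
Proof. by have /andP[] := @scan_valid [::] z (introT allP (fun x _ => isT)). Qed.

Lemma lew_rho_ctx w w' : lew w w' -> forall z0 z3 S,
  all (ok S) (z0 ++ w ++ z3) -> has_col S (scan (z0 ++ w ++ z3)) ->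
  has_col S (scan (z0 ++ w' ++ z3)) /\
  lew (rho S (z0 ++ w ++ z3)) (rho S (z0 ++ w' ++ z3)).
Proof.
have gen w1 w2 z0 z3 S :
    (forall p, valid S p -> all (ok S) w1 -> srel S (read p w1) (read p w2)) ->
    perm_eq w1 w2 -> all (ok S) (z0 ++ w1 ++ z3) ->
    has_col S (scan (z0 ++ w1 ++ z3)) ->
    has_col S (scan (z0 ++ w2 ++ z3)) /\
    lew (rho S (z0 ++ w1 ++ z3)) (rho S (z0 ++ w2 ++ z3)).
  move=> h pw; rewrite !all_cat => /and3P[ok0 ok1 ok3].
  have ok2 : all (ok S) w2 by rewrite -(perm_all _ pw).
  rewrite /rho /scan !read_cat -/(scan z3); have v3 := scan_valid ok3.
  have [v1 v2] := (read_valid v3 ok1, read_valid v3 ok2).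
  by apply: srel_final; [exact: read_valid | exact: read_valid | apply: srel_read (h _ v3 ok1)].
elim=> {w w'}.
- by move=> w z0 z3 S _ hS; split=> //; apply: lew_refl.
- move=> v u w uv IH1 vw IH2 z0 z3 S okS hS.
  have [hS1 l1] := IH1 z0 z3 S okS hS.
  have okS1 : all (ok S) (z0 ++ v ++ z3).
    by move: okS; rewrite !all_cat (perm_all _ (lew_perm uv)).
  have [hS2 l2] := IH2 z0 z3 S okS1 hS1.
  by split=> //; apply: lew_trans l1 l2.
- move=> u u' v v' uu' IH1 vv' IH2 z0 z3 S; rewrite -!catA => okS hS.
  have [hS1 l1] := IH1 z0 (v ++ z3) S okS hS.
  have okS1 : all (ok S) ((z0 ++ u') ++ v ++ z3).
    by move: okS; rewrite !all_cat (perm_all _ (lew_perm uu')) andbA.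
  rewrite catA in hS1 l1; have [hS2 l2] := IH2 (z0 ++ u') z3 S okS1 hS1.
  by rewrite -!catA in hS2 l1 l2 *; split=> //; apply: lew_trans l1 l2.
- move=> a b ab z0 z3 S; apply: gen => [p v|]; last exact/lew_perm/lew_swap.
  by case/and3P=> oka okb _; apply: srel_swap.
- move=> x Q c cQ Qc cx z0 z3 S; apply: gen => [p v|]; last exact/lew_perm/lew_jumpr.
  by rewrite /= all_cat /= => /and4P[_ _ okc _]; apply: srel_jumpr.
- move=> c x Q cQ Qc cx z0 z3 S; apply: gen => [p v _|]; last exact/lew_perm/lew_jumpl.
  exact: srel_jumpl.
Qed.

Lemma lew_rho S z z' : lew z z' -> all (ok S) z -> has_col S (scan z) ->
  has_col S (scan z') /\ lew (rho S z) (rho S z').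
Proof. by move=> /lew_rho_ctx/(_ [::] [::] S); rewrite /= !cats0. Qed.

Lemma scan_nil w : (scan w).1 = [::] -> w = [::].
Proof. by case: w => //= q w; rewrite /bump; case: ifP => //= h e; rewrite e in h. Qed.

Lemma srel_start S w : all (ok S) w -> srel S ([::], w) (scan w).
Proof.
move=> okw; have /andP[cC okC] := scan_valid okw.
have lw : lew w ((scan w).1 ++ (scan w).2) by have := @read_lew w ([::], [::]) isT; rewrite /= !cats0.
move eC: ((scan w).1) => C; case: (lastP C) eC => [|D b] eC {C}.
  by rewrite (scan_nil eC); left; split=> //; apply: lew_refl.
right; exists b.
have Db : all (leq b) (rcons D b).
  move: cC; rewrite eC -cats1 col_cat allrel1r => /and3P[h _ _].
  rewrite all_cat /= leqnn !andbT; apply: sub_all h => x; nlia.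
split=> //; first by rewrite eC in okC; apply: (allP okC); rewrite mem_rcons mem_head.
split; rewrite eC /=.
  apply/esym/eqP; rewrite -[_ == _]negbK -has_filter; apply/hasPn => x /(allP Db) /=.
  by rewrite -leqNgt.
move=> F cF Fb okF; rewrite (up_id Db).
apply: lew_trans (lew_catl F lw) _; rewrite eC; apply: lew_swaps.
by apply: allrel_memP => x y /(allP Fb) ? /(allP Db); nlia.
Qed.

Lemma lew_append S z w : all (ok S) (z ++ w) -> has_col S (scan z) ->
  has_col S (scan (z ++ w)) /\ lew (rho S z ++ w) (rho S (z ++ w)).
Proof.
rewrite all_cat => /andP[okz okw] hS.
have r := srel_read (valid_nil S w) (scan_valid okw) okz (srel_start okw).
have /srel_final : valid S (read ([::], w) z) by apply: read_valid.
move=> /(_ (read (scan w) z)); rewrite -[w in read (_, w)]cat0s read_tail -read_cat.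
rewrite -[w in srel _ (read (_, w) _)]cat0s read_tail -read_cat in r.
by move=> /(_ (scan_valid _) r hS); rewrite all_cat okz okw /final /= catA; apply.
Qed.

Lemma scan_col B : col B -> scan B = (B, [::]).
Proof.
rewrite /scan; elim: B => //= b B IH; rewrite colE => /andP[Bb /IH ->].
exact: bump_max.
Qed.

Lemma sim_next S b b' C X C' X' : col C -> col C' -> all (ok S) C -> b < b' ->
  (forall y, ok S y -> y < b' -> y <= b) -> b \in C -> b \notin C' ->
  sim S b (C, X) (C', X') ->
  sim S b' (C, b :: X) (b :: lo b C', hi b C' ++ X').
Proof.
move=> cC cC' okC bb' next bC bC' [/= eqlo h].
have upC : up b' C = hi b C.
  apply: eq_in_filter => y /(allP okC) /next; case: leqP; nlia.
have loC : lo b' C = b :: lo b C.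
  have -> : lo b' C = [seq y <- C | y <= b].
    by apply: eq_in_filter => y /(allP okC) /next; case: ltnP; nlia.
  rewrite {1}(col_hi_mid_lo cC bC) filter_cat /= leqnn.
  rewrite [X in X ++ _](_ : _ = [::]) /=; last first.
    apply/eqP; rewrite -[_ == _]negbK -has_filter; apply/hasPn => x /(allP (all_hi b C)) /=.
    by rewrite -ltnNge.
  by congr (_ :: _); apply/all_filterP; apply: (sub_all _ (all_lo b C)) => x; nlia.
have lo'b : all (gtn b') (b :: lo b C').
  by rewrite /= bb'; apply: (sub_all _ (all_lo b C')) => x; nlia.
have upCb : up b C = hi b C ++ [:: b].
  rewrite {1}(col_hi_mid_lo cC bC) {1}/up filter_cat /= leqnn; congr (_ ++ _ :: _).
    by apply/all_filterP/allP => x; rewrite !memE => /andP[? _]; nlia.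
  by apply: up_nil; apply: all_lo.
rewrite upCb (up_hi bC') in h.
split; first by rewrite [LHS]loC [RHS]lo_id // eqlo.
move=> F cF Fb okF; rewrite [up b' _]upC [up b' _]up_nil //=.
have Fleb : all (geq b) F.
  apply/allP => y yF; apply: next; [exact: (allP okF) | exact: (allP Fb)].
have [bF|bF] := boolP (b \in F); last first.
  have Fltb : all (gtn b) F.
    apply/allP => y yF; have /= := allP Fleb y yF; rewrite leq_eqVlt => /orP[/eqP e|//].
    by rewrite -e yF in bF.
  apply: (@lew_trans (F ++ hi b C ++ b :: X)).
    by apply: lew_jumprs; rewrite ?Fltb ?all_hi //; apply: col_filter.
  by apply: lew_catl; have := h [::] isT isT isT; rewrite -catA.
have [F2 eF] := col_headE cF bF Fleb; rewrite eF colE in cF okF *.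
case/andP: cF => F2b cF2; case/andP: okF => okb okF2.
apply: (@lew_trans (hi b C ++ [:: b] ++ b :: F2 ++ X)).
  by rewrite /=; apply/lew_catl/lew_cons/lew_back.
apply: (@lew_trans ([:: b] ++ hi b C ++ b :: F2 ++ X)).
  by apply: lew_jumprs; rewrite ?all_hi ?eqxx ?orbT //; apply: col_filter.
rewrite /=; apply: (@lew_trans (b :: hi b C' ++ F2 ++ X')).
  by apply: lew_cons; have := h F2 cF2 F2b okF2; rewrite -catA.
by apply: lew_fall; rewrite ?all_hi //; apply: col_filter.
Qed.

(* In the last case [p'] still lacks the letter [b] of [S], so that this cannot
   be the situation at the end of a run with [has_col S p']. *)
Definition vrel (S : word) (p p' : word * word) : Prop :=
  [\/ p.1 = p'.1 /\ lew p.2 p'.2,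
      exists2 b, all (gtn b) S & sim S b p p'
    | exists S1 b S2, [/\ S = S1 ++ b :: S2, all (mem p.1) S2, b \notin p'.1 & sim S b p p']].

Lemma sim_new S b q p p' : valid S p -> valid S p' -> q < b -> q \notin p.1 ->
  sim S b p p' ->
  [/\ (bump q p).1 = (bump q p').1, lew (bump q p).2 (bump q p').2 & q \notin p'.1].
Proof.
case: p p' => [C X] [C' X'] /andP[/= c _] /andP[/= c' okC'] qb qC [/= eqlo h].
have qC' : q \notin C'.
  by have := mem_lo b C q; rewrite eqlo mem_lo qb /= => ->.
rewrite !bump_notin //=; split=> //.
  by rewrite -(lo_lo C (ltnW qb)) eqlo lo_lo // ltnW.
rewrite (hi_split c qb) (hi_split c' qb) eqlo -!catA; apply: h.
- by do 2 apply: col_filter.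
- by apply/allP=> x; rewrite !memE => /and3P[].
- by apply/allP=> x; rewrite !memE => /and3P[_ _ /(allP okC')].
Qed.

Lemma sim_mem S b q p p' : q < b -> sim S b p p' -> (q \in p.1) = (q \in p'.1).
Proof. by move=> qb [eqlo _]; have := mem_lo b p.1 q; rewrite eqlo mem_lo qb. Qed.

Lemma vrel_bump S q p p' : col S -> valid S p -> valid S p' -> ok S q ->
  vrel S p p' -> vrel S (bump q p) (bump q p').
Proof.
case: p p' => [C X] [C' X'] cS v v' okq.
have /andP[/= c okC] := v; have /andP[/= c' okC'] := v'.
case=> [[/= <- XX']|[b bS sm]|[S1 [b [S2 [eS S2C bC' sm]]]]].
- apply: Or31; rewrite /bump /=; case: ifP => _ /=; split=> //; first exact: lew_cons.
  exact: lew_catl.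
- have [qb|bq] := ltnP q b; last by apply: Or32; exists b => //; apply: sim_large.
  have [qC|qC] := boolP (q \in C).
    apply: Or32; exists b => //; apply: sim_pass => //.
    by rewrite -(sim_mem qb sm).
  by apply: Or31; have [] := sim_new v v' qb qC sm.
rewrite /= in S2C bC'; have [cS1 cS2 bS1 bS2 _] : [/\ col S1, col S2, all (ltn b) S1, all (gtn b) S2 & allrel gtn S1 S2] by apply: col_mid; rewrite -eS.
have [qb|] := ltnP q b.
  have qS2 : q \in S2.
    move: okq; rewrite /ok eS mem_cat inE all_cat /= => /orP[/or3P[/(allP bS1)|/eqP|//]|/and3P[_ ? _]]; nlia.
  have qC : q \in C by apply: (allP S2C).
  apply: Or33; exists S1, b, S2; split=> //; rewrite ?bump_in // -?(sim_mem qb sm) //.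
  by rewrite -!bump_in -?(sim_mem qb sm) //; apply: sim_pass; rewrite -?(sim_mem qb sm).
rewrite leq_eqVlt => /orP[/eqP <-|bq]; last first.
  apply: Or33; exists S1, b, S2; split=> //; last by apply: sim_large => //; apply: ltnW.
    apply/allP => s sS; have sC := allP S2C s sS; have /= sb := allP bS2 s sS.
    rewrite /bump /=; case: ifP => //= _; rewrite !memE.
    by rewrite (ltn_trans sb bq) [s \in C]sC orbT.
  rewrite /bump /=; case: ifP => //= _; rewrite !memE (negPf bC') andbF orbF.
  by apply/eqP; nlia.
rewrite (bump_notin _ bC').
have [bC|bC] := boolP (b \in C); last first.
  case: sm => /= eqlo /(_ [::] isT isT isT) /=; rewrite !up_hi // => h.
  by apply: Or31; rewrite bump_notin // eqlo.
rewrite bump_in //.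
case: (lastP S1) eS cS1 bS1 => [|S0 b'] eS cS1 bS1.
  apply: Or32; exists b.+1.
    by rewrite eS /= ltnSn; apply: (sub_all _ bS2) => x; nlia.
  by apply: sim_next sm.
have bb' : b < b' by move/allP: bS1; apply; rewrite mem_rcons mem_head.
apply: Or33; exists S0, b', (b :: S2); split.
- by rewrite eS cat_rcons.
- by rewrite /= S2C andbT.
- by rewrite /= !memE; apply/negP => /orP[/eqP|/andP[]]; nlia.
apply: sim_next sm => // y; rewrite /ok => + yb'.
have cS1' : all (leq b') (rcons S0 b').
  move: cS1; rewrite -cats1 col_cat allrel1r => /and3P[h _ _].
  rewrite all_cat /= leqnn !andbT; apply: sub_all h => x; nlia.
case/orP=> [|/allP yS].
  by rewrite eS mem_cat inE => /or3P[/(allP cS1')|/eqP|/(allP bS2)]; nlia.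
have /= : b' < y by apply: yS; rewrite eS mem_cat mem_rcons mem_head.
nlia.
Qed.

Lemma vrel_read S z p p' : col S -> valid S p -> valid S p' -> all (ok S) z ->
  vrel S p p' -> vrel S (read p z) (read p' z).
Proof.
move=> cS v v'; elim: z => //= q z IH /andP[okq okz] r.
by apply: vrel_bump => //; [apply: read_valid | apply: read_valid | apply: IH].
Qed.

Lemma vrel_final S p p' : valid S p -> valid S p' -> vrel S p p' ->
  has_col S p' -> lew (final S p) (final S p').
Proof.
move=> v v' + SC'; case=> [[e XX']|[b Sb sm]|[S1 [b [S2 [eS _ bC' _]]]]].
- by rewrite /final e; apply: lew_catl.
- apply: (srel_final v v' _ _).2; last first.
    apply/allP => s sS /=; rewrite (@sim_mem S b s p p') //; first exact: (allP SC').
    exact: (allP Sb).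
  right; exists b; split=> //; first by rewrite /ok Sb orbT.
  by move=> /(allP Sb); nlia.
by move: bC'; rewrite [b \in _](allP SC') // eS mem_cat mem_head orbT.
Qed.

Lemma vrel_start S B : col S -> col B -> all (ok S) B -> vrel S (B, [::]) ([::], B).
Proof.
move=> cS cB okB; case: (lastP S) cS okB => [|S1 b] cS okB.
  apply: Or32; exists 0 => //; split=> /= [|F _]; first by rewrite /lo filter_pred0.
  case: F => //= _ _; rewrite /up filter_predT cats0; exact: lew_refl.
have small y : ok (rcons S1 b) y -> b <= y.
  move: cS; rewrite -cats1 col_cat allrel1r => /and3P[h _ _].
  rewrite /ok mem_cat inE all_cat /= => /orP[/orP[/(allP h)|/eqP]|/and3P[_ ? _]]; nlia.
apply: Or33; exists S1, b, [::]; split=> //; first by rewrite cats1.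
have bB : all (leq b) B by apply: sub_all okB.
split=> /=.
  apply/eqP; rewrite -[_ == _]negbK -has_filter; apply/hasPn => x /(allP bB) /=.
  by rewrite -leqNgt.
case=> [|f F] _ /= => [_ _|/andP[fb _] /andP[/small]].
  by rewrite up_id // cats0; apply: lew_refl.
by nlia.
Qed.

Lemma lew_reverse S z B : col S -> col B -> all (ok S) (z ++ B) ->
  has_col S (scan z) -> lew (rho S (z ++ B)) (rho S z ++ B).
Proof.
move=> cS cB; rewrite all_cat => /andP[okz okB] hS.
have vB : valid S (B, [::]) by rewrite /valid cB.
have := vrel_read cS vB (valid_nil S B) okz (vrel_start cS cB okB).
move/(vrel_final (read_valid vB okz) (read_valid (valid_nil S B) okz)).
rewrite /rho /scan read_cat -/(scan B) (scan_col cB) -[B in ([::], B)]cat0s read_tail.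
by rewrite /final /= catA; apply.
Qed.

(** * The acceptance test and the exchange of two rows *)

Lemma ok_suffix P1 s q : ok (P1 ++ s) q -> col (P1 ++ s) ->
  q \notin s -> all (gtn q) s.
Proof.
rewrite /ok mem_cat all_cat => + + qs; rewrite (negPf qs) orbF.
case/orP=> [qP|/andP[//]]; rewrite col_cat => /and3P[/allrelP h _ _].
by apply/allP => x; apply: h.
Qed.

Lemma bump_self q p : q \in (bump q p).1.
Proof. by rewrite /bump; case: ifP => //= _; rewrite mem_head. Qed.

Lemma bump_keep q p s : all (gtn q) s -> all (mem p.1) s -> all (mem (bump q p).1) s.
Proof.
move=> /allP sq /allP sp; apply/allP => x xs; have /= xp := sp x xs.
by have /= xq := sq x xs; rewrite /bump /=; case: ifP => //= _; rewrite !memE xq xp orbT.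
Qed.

Lemma subseq_scan P1 s z : col (P1 ++ s) -> all (ok (P1 ++ s)) z ->
  subseq s z -> all (mem (scan z).1) s.
Proof.
elim: z s P1 => [|q z IH] s P1 cP; first by move=> _ /eqP ->.
rewrite -[scan _]/(bump q (scan z)) [all _ _]/= => /andP[okq okz] sz.
have [qs|qs] := boolP (q \in s); last first.
  apply: bump_keep; first exact: ok_suffix okq cP qs.
  apply: IH cP okz _; case: s qs sz {okq} => [|a s]; first by rewrite !sub0seq.
  by rewrite inE negb_or eq_sym /= => /andP[/negPf ->].
case: s cP okq okz qs sz => // a s cP okq okz qs /=.
have /andP[as_ cs] : all (gtn a) s && col s.
  by move: cP; rewrite col_cat colE => /and3P[].
case: eqP => [eqa sz|nqa].
  subst q; rewrite bump_self /=; apply: bump_keep => //.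
  by apply: (IH _ (P1 ++ [:: a])); rewrite -?catA.
move=> sz; have := IH (a :: s) P1 cP okz sz.
move: qs; rewrite inE => /orP[/eqP e|qs]; first by case: nqa.
move=> /= /andP[aC sC]; have qC : q \in (scan z).1 by apply: (allP sC).
by rewrite /bump qC /= aC.
Qed.

Lemma scan_subseq z : subseq (scan z).1 z.
Proof.
elim: z => //= q z IH; rewrite /bump; case: ifP => _ /=.
  exact: subseq_trans IH (subseq_cons _ _).
by rewrite eqxx; apply: subseq_trans (filter_subseq _ _) IH.
Qed.

Lemma col_subseq s t : col s -> col t -> all (mem t) s -> subseq s t.
Proof.
move=> cs ct /allP st; suff -> : s = [seq x <- t | x \in s] by apply: filter_subseq.
apply: col_eq => // [|x]; first exact: col_filter.
by rewrite mem_filter; have [/st|] := boolP (x \in s).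
Qed.

Lemma subseq_catP (T : eqType) (s u v : seq T) : subseq s (u ++ v) ->
  exists s1 s2, [/\ s = s1 ++ s2, subseq s1 u & subseq s2 v].
Proof.
elim: u s => [|a u IH] s /=; first by exists [::], s.
case: s => [|b s] /=; first by exists [::], [::]; rewrite !sub0seq.
case: eqP => [->|_] /IH[s1 [s2 [e h1 h2]]].
  by exists (a :: s1), s2; rewrite e /= eqxx.
exists s1, s2; split=> //; exact: subseq_trans h1 (subseq_cons _ _).
Qed.

Lemma read_col_suffix B P1 s z : col (P1 ++ s) ->
  all (ok (P1 ++ s)) z -> subseq s (read (B, [::]) z).2 ->
  subseq s z /\ all (mem (read (B, [::]) z).1) s.
Proof.
elim: z s P1 => [|q z IH] s P1 cP /=; first by move=> _ /eqP ->.
case/andP=> okq okz; case eR: (read _ z) => [C X] in IH *.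
rewrite /bump /=; case: ifPn => qC /=.
  case: s cP okq okz => [|a s] /= cP okq okz; first by [].
  case: eqP => [e sX|_ sX].
    subst q; have [|||h1 h2] := IH s (P1 ++ [:: a]); rewrite -?catA //.
    by rewrite h1 [a \in C]qC.
  have [h1 h2] := IH _ _ cP okz sX; by split.
move=> /subseq_catP[s1 [s2 [es h1 h2]]].
have eP : P1 ++ s = (P1 ++ s1) ++ s2 by rewrite es catA.
rewrite eP in cP okq okz.
have [sz sC] := IH s2 (P1 ++ s1) cP okz h2.
have qs2 : q \notin s2 by apply: contra qC => /(allP sC).
have sq := ok_suffix okq cP qs2.
case: s1 => [|a s1] in es h1 eP cP okq okz *.
  rewrite es; split; first exact: subseq_trans sz (subseq_cons _ _).
  by have := bump_keep (p := (C, X)) sq sC; rewrite bump_notin.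
have qa : q < a by have := mem_subseq h1 (mem_head a s1); rewrite mem_hi => /andP[].
have qP : q \in P1 ++ a :: s1 ++ s2.
  move: okq; rewrite /ok -catA /= => /orP[//|]; rewrite all_cat /= => /and3P[_ ? _]; nlia.
have [_ _ P1a _ _] : [/\ col P1, col (s1 ++ s2), all (ltn a) P1, all (gtn a) (s1 ++ s2) & allrel gtn P1 (s1 ++ s2)].
  by apply: col_mid; rewrite -catA in cP.
move: qP; rewrite mem_cat inE mem_cat (negPf qs2) orbF => /or3P[/(allP P1a)|/eqP|qs1]; [nlia|nlia|].
have := mem_subseq h1 (_ : q \in a :: s1); rewrite inE qs1 orbT mem_hi => /(_ isT) /andP[]; nlia.
Qed.

(* [v] is the word which the rows [Ds] have to emit in order to become [Ts].
   A row holding [A] at the end is the same as a row emitting [A] last. *)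
Fixpoint acc (Ds Ts : seq word) (v : word) : bool :=
  match Ds, Ts with
  | [::], [::] => v == [::]
  | P :: Ds', A :: Ts' => has_col P (scan (v ++ A)) && acc Ds' Ts' (rho P (v ++ A))
  | _, _ => false
  end.

Fixpoint nwrows (Ds : seq word) : bool :=
  if Ds is P :: Ds' then [&& col P, all (ok P) (flatten Ds') & nwrows Ds'] else true.

Lemma rho_perm S z : col S -> has_col S (scan z) -> perm_eq (S ++ rho S z) z.
Proof.
move=> cS hS; have cC := col_scan z.
have := @read_perm z ([::], [::]) isT; rewrite /= !cats0 -/(scan z) perm_sym => h.
apply: perm_trans h; rewrite /rho /final catA perm_cat2r.
rewrite perm_sym -(perm_filterC (mem S)) perm_cat2r.
apply: uniq_perm; [exact/filter_uniq/col_uniq | exact: col_uniq | move=> x].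
by rewrite mem_filter /=; have [xS|] := boolP (x \in S) => //=; apply: (allP hS).
Qed.

Lemma acc_perm Ds Ts v : nwrows Ds -> acc Ds Ts v -> perm_eq (v ++ flatten Ts) (flatten Ds).
Proof.
elim: Ds Ts v => [|S Ds IH] [|A Ts] v //=; first by move=> _ /eqP ->.
case/and3P=> cS _ nwD /andP[hS /(IH _ _ nwD) p].
rewrite catA -(perm_cat2l S) catA in p *.
apply: perm_trans p; rewrite perm_cat2r perm_sym; exact: rho_perm.
Qed.

Lemma ok_self S : all (ok S) S.
Proof. by apply/allP => x xS; rewrite /ok xS. Qed.

Lemma acc_ok S Ds A Ts v : nwrows (S :: Ds) -> acc (S :: Ds) (A :: Ts) v ->
  all (ok S) (v ++ A).
Proof.
move=> nwD h; have : all (ok S) (flatten (S :: Ds)).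
  by case/and3P: nwD => cS okD _; rewrite /= all_cat ok_self.
by rewrite -(perm_all _ (acc_perm nwD h)) /= catA all_cat => /andP[].
Qed.

Lemma acc_mono Ds Ts v v' : nwrows Ds -> lew v v' -> acc Ds Ts v -> acc Ds Ts v'.
Proof.
elim: Ds Ts v v' => [|S Ds IH] [|A Ts] v v' //.
  by move=> _ /lew_perm + /eqP e; rewrite e perm_sym => /perm_nilP ->.
move=> nwD vv' h; have okv := acc_ok nwD h.
move: h nwD => /= /andP[hS h] /and3P[_ _ nwD].
have [-> l] := lew_rho (lew_catr A vv') okv hS; exact: IH l h.
Qed.

Lemma acc_step Ds Ts S A v z : nwrows (S :: Ds) -> acc (S :: Ds) (A :: Ts) v ->
  lew (v ++ A) z -> has_col S (scan z) && acc Ds Ts (rho S z).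
Proof.
move=> nwD h l; have okv := acc_ok nwD h.
move: h nwD => /= /andP[hS h] /and3P[_ _ nwD].
by have [-> l'] := lew_rho l okv hS; apply: acc_mono l' h.
Qed.

(* The word to be fed to [P] is [rho P (v ++ A)].  Since [P] is contained in
   [Q], appending [B] to it or to [v ++ A] makes no difference up to [lew] in
   both directions, so that only the word [A ++ B] matters. *)
Lemma acc_pair P Q Ds A B A' B' Ts v : nwrows (P :: Q :: Ds) -> all (mem Q) P ->
  col B' -> lew (A ++ B) (A' ++ B') ->
  acc (P :: Q :: Ds) (A :: B :: Ts) v -> acc (P :: Q :: Ds) (A' :: B' :: Ts) v.
Proof.
move=> nwD PQ cB' AB h; have okA := acc_ok nwD h.
have permT := acc_perm nwD h.
have /and3P[cP _ nwQ] := nwD.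
have /and3P[cQ _ _] := nwQ.
move: h => /andP[hP hQ].
have okAB : all (ok P) ((v ++ A) ++ B).
  have : all (ok P) (flatten (P :: Q :: Ds)).
    by case/and3P: nwD => _ okQD _; rewrite -cat1s flatten_cat all_cat okQD /= cats0 ok_self.
  by rewrite -(perm_all _ permT) /= !all_cat => /and4P[-> -> ->].
have [hP1 l1] := lew_append okAB hP.
have lAB : lew ((v ++ A) ++ B) ((v ++ A') ++ B').
  by rewrite -!catA; apply: lew_catl.
have [hP2 l2] := lew_rho lAB okAB hP1.
have {}okAB : all (ok P) ((v ++ A') ++ B') by rewrite -(perm_all _ (lew_perm lAB)).
have okA' : all (ok P) (v ++ A') by move: okAB; rewrite all_cat => /andP[].
have /andP[hQ2 _] := acc_step nwQ hQ (lew_trans l1 l2).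
have PsubN : all (mem (scan (rho P ((v ++ A') ++ B'))).1) P.
  by apply/allP => x /(allP PQ) /(allP hQ2).
have P_rho : subseq P (rho P ((v ++ A') ++ B')).
  apply: subseq_trans (scan_subseq _); apply: col_subseq => //.
  exact: col_scan.
have {PsubN}hP' : has_col P (scan (v ++ A')).
  apply: (@subseq_scan [::]) => //.
  apply: (read_col_suffix (B := B') (P1 := [::]) _ _ _).1 => //.
  rewrite /rho /scan read_cat -/(scan B') scan_col // /final in P_rho.
  have [s1 [s2 [e h1 h2]]] := subseq_catP P_rho.
  case: s1 e h1 => [|a s1] e h1; first by rewrite e.
  have := mem_subseq h1 (mem_head a s1).
  by rewrite mem_filter e mem_head.
have l3 := lew_reverse cP cB' okAB hP'.
rewrite [acc _ _ _]/= hP' /=.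
exact: acc_step nwQ hQ (lew_trans l1 (lew_trans l2 l3)).
Qed.

Lemma lew_dominated D A B : col (D ++ A) -> col (D ++ B) ->
  (forall y, count (leq y) A <= count (leq y) B) ->
  lew (D ++ A ++ B) (A ++ D ++ B).
Proof.
elim: A D B => [|a A IH] D B; first by move=> *; apply: lew_refl.
move=> cDA cDB le_count.
move: (cDA); rewrite col_cat allrel_consr => /and3P[/andP[Da DA] cD caA].
move: (caA); rewrite colE => /andP[Aa cA].
case: B cDB le_count => [|b B] cDB le_count.
  by have := le_count a; rewrite /= leqnn.
move: (cDB); rewrite col_cat allrel_consr colE => /and3P[/andP[Db DB] _ /andP[Bb cB]].
have ab : a <= b.
  have := le_count a; rewrite /= leqnn leqNgt; apply: contraNT; rewrite -ltnNge => ba.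
  rewrite (leqNgt a) ba /= add0n; suff -> : count (leq a) B = 0 by [].
  apply/eqP; rewrite -leqn0 leqNgt -has_count; apply/hasPn => x /(allP Bb) /=.
  by rewrite -ltnNge => xb; apply: ltn_trans xb ba.
move: ab; rewrite leq_eqVlt => /orP[/eqP e|ab]; last first.
  apply: lew_jumprs => //; apply/orP; left; rewrite /= ab.
  by apply: sub_all Aa => x; nlia.
rewrite -e in Db Bb cDB le_count *.
apply: (@lew_trans (D ++ [:: a] ++ a :: A ++ B)).
  by rewrite /=; apply/lew_catl/lew_cons; apply: lew_back.
apply: (@lew_trans ([:: a] ++ D ++ a :: A ++ B)).
  by apply: lew_jumprs; rewrite ?eqxx ?orbT.
apply: lew_cons; rewrite -!cat_rcons -!cats1; apply: IH; rewrite -?catA // => y.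
by have := le_count y; rewrite /= leq_add2l.
Qed.

Lemma lew_knuth A1 x A2 B1 B2 : col (x :: A2) -> col (B1 ++ x :: B2) ->
  (forall y, count (leq y) A2 <= count (leq y) B2) ->
  lew ((A1 ++ x :: A2) ++ B1 ++ B2) ((A1 ++ A2) ++ B1 ++ x :: B2).
Proof.
move=> cA cB le_count; have [cB1 cB2 xB1 B2x B12] := col_mid cB.
have /andP[A2x cA2] := cA.
rewrite -!catA; apply: lew_catl; apply: (@lew_trans (B1 ++ (x :: A2) ++ B2)).
  apply: (@lew_swaps (x :: A2) B1); rewrite allrel_consl xB1 /=.
  by apply: allrel_memP => y z /(allP A2x) ? /(allP xB1); nlia.
have := @lew_dominated (B1 ++ [:: x]) A2 B2; rewrite -!catA /=; apply=> //.
rewrite col_cat cA cB1 !andbT allrel_consr; apply/andP; split=> //.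
by apply: allrel_memP => y z /(allP xB1) ? /(allP A2x); nlia.
Qed.

Definition ins (a : nat) (s : word) : word := hi a s ++ a :: lo a s.

Lemma mem_ins a s x : (x \in ins a s) = (x == a) || (x \in s).
Proof.
rewrite /ins !memE; by case: (ltngtP x a) => _; case: (x \in s).
Qed.

Lemma col_ins a s : col s -> col (ins a s).
Proof.
move=> cs; rewrite col_cat allrel_consr colE !col_filter // all_lo !andbT.
apply/andP; split; first by apply/allP => x; rewrite !memE => /andP[].
by apply: allrel_memP => x y; rewrite !memE => /andP[? _] /andP[? _] /=; nlia.
Qed.

Definition rmove (Ts Us : seq word) : Prop :=
  exists pre s M a R Q,
    [/\ Ts = pre ++ s :: M ++ (a :: R) :: Q, a \notin s, all (fun A => a \in A) M
      & Us = pre ++ ins a s :: M ++ R :: Q].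

Lemma acc_okall P Ds Ts v : nwrows (P :: Ds) -> acc (P :: Ds) Ts v ->
  all (ok P) (v ++ flatten Ts).
Proof.
move=> nwD h; rewrite (perm_all _ (acc_perm nwD h)); case/and3P: nwD => cP okD _.
by rewrite /= all_cat ok_self.
Qed.

Lemma acc_out Ds M a R Q v v' : nwrows Ds -> all col M -> all (fun A => a \in A) M ->
  lew (v ++ [:: a]) v' -> acc Ds (M ++ (a :: R) :: Q) v -> acc Ds (M ++ R :: Q) v'.
Proof.
elim: M Ds v v' => [|A M IH] [|P Ds] v v' // nwD cM aM l h.
  by apply: acc_step nwD h _; rewrite -cat1s catA; apply: lew_catr.
have /andP[cA cM'] := cM; have /andP[aA aM'] := aM.
have okA := acc_ok nwD h; have okall := acc_okall nwD h.
move: h => /andP[hP h].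
have okAa : all (ok P) ((v ++ A) ++ [:: a]).
  by rewrite all_cat okA /= andbT; apply: (allP okA); rewrite mem_cat aA orbT.
have [hP1 l1] := lew_append okAa hP.
have l2 : lew ((v ++ A) ++ [:: a]) (v' ++ A).
  apply: (@lew_trans ((v ++ [:: a]) ++ A)); last exact: lew_catr.
  rewrite -!catA; apply: lew_catl; rewrite -[A in lew _ (_ ++ A)]cats0; exact: lew_passl.
have [hP2 l3] := lew_rho l2 okAa hP1.
rewrite [acc _ _ _]/= hP2; apply: IH h => //; first by case/and3P: nwD.
exact: lew_trans l1 l3.
Qed.

Lemma acc_cat pre Ds Ts Us v : nwrows Ds ->
  (forall Ds' v', nwrows Ds' -> acc Ds' Ts v' -> acc Ds' Us v') ->
  acc Ds (pre ++ Ts) v -> acc Ds (pre ++ Us) v.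
Proof.
move=> + h; elim: pre Ds v => [|A pre IH] Ds v nwD; first exact: h.
case: Ds nwD => // P Ds /and3P[_ _ nwD] /= /andP[-> hT]; exact: IH hT.
Qed.

Lemma acc_rmove Ds Ts Us : nwrows Ds -> all col Ts -> rmove Ts Us ->
  acc Ds Ts [::] -> acc Ds Us [::].
Proof.
move=> nwD + [pre [s [M [a [R [Q [eT as_ aM eU]]]]]]]; rewrite {}eT {}eU.
rewrite all_cat /= all_cat => /and4P[_ cs cM _].
apply: acc_cat nwD _ => -[|P {}Ds] v nwD // h.
have oks := acc_ok nwD h; have okall := acc_okall nwD h.
move: h => /andP[hP h].
have okAa : all (ok P) ((v ++ s) ++ [:: a]).
  rewrite all_cat oks /= andbT; apply: (allP okall).
  by rewrite mem_cat /= flatten_cat !mem_cat /= mem_head !orbT.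
have [hP1 l1] := lew_append okAa hP.
have l2 : lew ((v ++ s) ++ [:: a]) (v ++ ins a s).
  rewrite -catA; apply: lew_catl; rewrite {1}(col_hi_lo cs as_) /ins -!catA; apply: lew_catl.
  by have := @lew_back a (lo a s) [::] (all_lo a s); rewrite cats0.
have [hP2 l3] := lew_rho l2 okAa hP1.
rewrite [acc _ _ _]/= hP2; apply: acc_out h => //; first by case/and3P: nwD.
exact: lew_trans l1 l3.
Qed.

Lemma acc_refl Ds : nwrows Ds -> acc Ds Ds [::].
Proof.
elim: Ds => //= P Ds IH /and3P[cP _ nwD]; rewrite /rho /has_col scan_col //=.
have -> : final P (P, [::]) = [::].
  rewrite /final cats0; apply/eqP; rewrite -[_ == _]negbK -has_filter.
  by apply/hasPn => x ->.
by rewrite IH // andbT; apply/allP.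
Qed.

(** * From acceptance to Kohnert moves *)

(* [mach s u v t]: a row containing [s] can take the letters [u] from below, emit
   the letters [v] upwards and contain [t] at the end. *)
Inductive mach : word -> word -> word -> word -> Prop :=
| mach_nil s : mach s [::] [::] s
| mach_in s a u v t : a \notin s -> mach (ins a s) u v t -> mach s (a :: u) v t
| mach_pass s a u v t : a \in s -> mach s u v t -> mach s (a :: u) (a :: v) t
| mach_out s a u v t : mach s u v t -> mach (a :: s) u (a :: v) t.

Lemma mach_silent s u v t : mach s u v t -> v = [::] -> all (mem t) s.
Proof.
elim=> {s u v t} // s a u v t _ _ IH /IH /allP st; apply/allP => x xs.
by apply: st; rewrite mem_ins xs orbT.
Qed.

Lemma mach_hold1 s u w t : mach s u w t -> col s ->
  forall v b, w = v ++ [:: b] -> all (gtn b) t -> mach s u v (b :: t).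
Proof.
elim=> {s u w t}.
- by move=> s _ [].
- move=> s a u v t as_ _ IH cs w b ev tb; apply: mach_in => //; apply: IH => //.
  exact: col_ins.
- move=> s a u v t as_ m IH cs [|a' w] b /= [e ev] tb.
    have /allP/(_ a as_) /= := mach_silent m ev.
    by move=> /(allP tb); rewrite -e /= ltnn.
  by rewrite -e; apply: mach_pass => //; apply: IH.
- move=> s a u v t m IH; rewrite colE => /andP[sa cs] [|a' w] b /= [e ev] tb.
    rewrite -e in tb *; rewrite ev in m => {ev v IH e b}.
    have : forall s v, mach s u v t -> v = [::] -> all (gtn a) t -> mach (a :: s) u [::] (a :: t).
      move=> {s m sa cs tb} s v; elim=> {s u v t} //; first by move=> s *; apply: mach_nil.
      move=> s c u v t cs m IH ev ta; have st := mach_silent m ev.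
      have /= ca : c < a.
        by have := allP ta c; rewrite /=; apply; apply: (allP st); rewrite mem_ins eqxx.
      have sa : all (gtn a) s.
        by apply/allP => x xs; apply: (allP ta); apply: (allP st); rewrite mem_ins xs orbT.
      apply: mach_in; first by rewrite inE negb_or cs andbT; apply/eqP; nlia.
      suff -> : ins c (a :: s) = a :: ins c s by apply: IH.
      by rewrite /ins /hi /lo /= ca ltnNge (ltnW ca).
    by move=> /(_ _ _ m erefl tb).
  by rewrite -e; apply: mach_out; apply: IH.
Qed.

Lemma mach_hold s u v B : mach s u (v ++ B) [::] -> col s -> col B -> mach s u v B.
Proof.
move=> + cs; suff h t : mach s u (v ++ B) t -> col (B ++ t) -> mach s u v (B ++ t).
  by move=> m cB; have := h [::] m; rewrite !cats0; apply.
elim/last_ind: B t => [|B b IH] t; first by rewrite cats0.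
rewrite -cats1 -[in col _]catA -[in mach s u v _]catA catA => m cB.
apply: IH => //=; apply: mach_hold1 m cs _ _ erefl _.
by move: cB; rewrite col_cat /= colE => /and3P[_ _ /andP[]].
Qed.

Lemma mach_fill C s w u v t : col C -> col s -> uniq w ->
  (forall x, x \in w -> x \notin s) -> C =i w ++ s ->
  mach C u v t -> mach s (w ++ u) v t.
Proof.
move=> cC; elim: w s => [|a w IH] s cs uw ws eC m.
  by rewrite -(col_eq cC cs eC).
have /andP[aw uw'] := uw; apply: mach_in; first by apply: ws; rewrite mem_head.
apply: IH => // [|x xw|x].
- exact: col_ins.
- rewrite mem_ins negb_or ws ?inE ?xw ?orbT // andbT.
  by apply/eqP => e; rewrite -e xw in aw.
- by rewrite eC [RHS]mem_cat mem_ins mem_cat inE -orbA orbCA.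
Qed.

Lemma mach_scan z : mach (scan z).1 (scan z).2 z [::].
Proof.
elim: z => [|q z IH]; first exact: mach_nil.
have cC := col_scan z.
rewrite -[scan _]/(bump q (scan z)) /bump; case: ifPn => qC /=; first exact: mach_pass.
apply: mach_out; apply: (mach_fill cC) IH; try by apply: col_filter.
- exact/filter_uniq/col_uniq.
- by move=> x; rewrite !memE => /andP[? _]; nlia.
- by move=> x; rewrite {1}(col_hi_lo cC qC).
Qed.

Lemma mach_rho S z : col S -> has_col S (scan z) -> mach S (rho S z) z [::].
Proof.
move=> cS hS.
have cC := col_scan z.
apply: (mach_fill cC) (mach_scan z) => // [|x|x].
- exact/filter_uniq/col_uniq.
- by rewrite mem_filter => /andP[].
- rewrite mem_cat mem_filter; have [xS|] := boolP (x \in S); last by rewrite orbF.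
  by rewrite orbT; apply: (allP hS).
Qed.

Inductive emit : seq word -> nat -> seq word -> Prop :=
| emit_out a s Ds : emit ((a :: s) :: Ds) a (s :: Ds)
| emit_pass s a Ds Es : a \in s -> emit Ds a Es -> emit (s :: Ds) a (s :: Es).

Inductive inner : seq word -> seq word -> Prop :=
| inner_in s a Ds Es : a \notin s -> emit Ds a Es -> inner (s :: Ds) (ins a s :: Es)
| inner_low s Ds Es : inner Ds Es -> inner (s :: Ds) (s :: Es).

(* [rrun Ds v Ts]: the rows [Ds] can be turned into [Ts] by Kohnert moves and by
   the emission of the letters [v] from the top row. *)
Inductive rrun : seq word -> word -> seq word -> Prop :=
| rrun_nil Ts : rrun Ts [::] Ts
| rrun_inner Ds Es v Ts : inner Ds Es -> rrun Es v Ts -> rrun Ds v Ts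
| rrun_emit Ds a Es v Ts : emit Ds a Es -> rrun Es v Ts -> rrun Ds (a :: v) Ts.

Lemma rrun_mach s u v t Ds Ts : mach s u v t -> rrun Ds u Ts -> rrun (s :: Ds) v (t :: Ts).
Proof.
move=> m; elim: m Ds Ts => {s u v t}.
- move=> s Ds Ts; move e: [::] => u r; elim: r e => {Ds u Ts} // Ds.
    by move=> _; apply: rrun_nil.
  by move=> Es v Ts i _ IH /IH; exact: rrun_inner (inner_low s i).
- move=> s a u v t as_ m IH Ds Ts; move e: (a :: u) => w r; elim: r e => {Ds w Ts} // Ds.
    by move=> Es w Ts' i _ IH' /IH'; exact: rrun_inner (inner_low s i).
  move=> b Es w Ts' em r _ [eb ew]; rewrite -{}eb -{}ew in em r.
  by apply: rrun_inner (IH _ _ r); apply: inner_in.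
- move=> s a u v t as_ m IH Ds Ts; move e: (a :: u) => w r; elim: r e => {Ds w Ts} // Ds.
    by move=> Es w Ts' i _ IH' /IH'; exact: rrun_inner (inner_low s i).
  move=> b Es w Ts' em r _ [eb ew]; rewrite -{}eb -{}ew in em r.
  by apply: rrun_emit (IH _ _ r); apply: emit_pass.
- move=> s a u v t m IH Ds Ts r; apply: rrun_emit (IH _ _ r); exact: emit_out.
Qed.

Lemma acc_rrun Ds Ts v : nwrows Ds -> all col Ts -> acc Ds Ts v -> rrun Ds v Ts.
Proof.
elim: Ds Ts v => [|P Ds IH] [|A Ts] v //=.
  by move=> _ _ /eqP ->; apply: rrun_nil.
case/and3P=> cP _ nwD /andP[cA cT] /andP[hP h].
apply: rrun_mach (IH _ _ nwD cT h); apply: mach_hold (mach_rho cP hP) cP cA.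
Qed.

Lemma emitP Ds a Es : emit Ds a Es -> exists M R Q,
  [/\ Ds = M ++ (a :: R) :: Q, all (fun A => a \in A) M & Es = M ++ R :: Q].
Proof.
elim=> {Ds a Es} [a s Ds|s a Ds Es as_ _ [M [R [Q [-> aM ->]]]]].
  by exists [::], s, Ds.
by exists (s :: M), R, Q; rewrite /= as_.
Qed.

Lemma innerP Ds Es : inner Ds Es -> rmove Ds Es.
Proof.
elim=> {Ds Es} [s a Ds Es as_ /emitP[M [R [Q [-> aM ->]]]]|].
  by exists [::], s, M, a, R, Q.
move=> s Ds Es _ [pre [s' [M [a [R [Q [-> as_ aM ->]]]]]]].
by exists (s :: pre), s', M, a, R, Q.
Qed.

Inductive rmoves : seq word -> seq word -> Prop :=
| rmoves_refl Ts : rmoves Ts Ts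
| rmoves_step Ds Es Ts : rmove Ds Es -> rmoves Es Ts -> rmoves Ds Ts.

Lemma acc_rmoves Ds Ts : nwrows Ds -> all col Ts -> acc Ds Ts [::] -> rmoves Ds Ts.
Proof.
move=> nwD cT /(acc_rrun nwD cT); move e: [::] => v r; elim: r e => {Ds v Ts nwD cT} //.
  by move=> Ts _; apply: rmoves_refl.
by move=> Ds Es v Ts /innerP i _ IH /IH; exact: rmoves_step i.
Qed.

(** * Diagrams and their rows *)

Local Open Scope fset_scope.

Definition repr (Ts : seq word) (T : cells) : Prop :=
  all col Ts /\ forall i c, ((i, c) \in T) = (0 < i) && (c \in nth [::] Ts i.-1).

Lemma repr_inj Ts T U : repr Ts T -> repr Ts U -> T = U.
Proof. by move=> [_ h] [_ h']; apply/fsetP => -[i c]; rewrite h h'. Qed.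

Lemma nth_mid (pre : seq word) A B Q i :
  nth [::] (pre ++ B :: Q) i = if i == size pre then B else nth [::] (pre ++ A :: Q) i.
Proof.
rewrite !nth_cat; case: (ltngtP i (size pre)) => // [h|->]; last by rewrite subnn.
by rewrite -(subnSK h).
Qed.

Lemma nth_two (pre : seq word) A A' M B B' Q i :
  let j := size pre in let k := (size pre + size M).+1 in
  nth [::] (pre ++ A' :: M ++ B' :: Q) i =
  if i == j then A' else if i == k then B' else nth [::] (pre ++ A :: M ++ B :: Q) i.
Proof.
move=> j k; rewrite (nth_mid _ A); case: eqP => // _.
have := @nth_mid (pre ++ A :: M) B B' Q i; rewrite -!catA /= => ->.
by rewrite size_cat /= addnS.
Qed.

Lemma nth_fst (pre : seq word) A Q : nth [::] (pre ++ A :: Q) (size pre) = A.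
Proof. by rewrite nth_cat ltnn subnn. Qed.

Lemma nth_snd (pre : seq word) A M B Q :
  nth [::] (pre ++ A :: M ++ B :: Q) (size pre + size M).+1 = B.
Proof.
by have := @nth_fst (pre ++ A :: M) B Q; rewrite -!catA size_cat /= addnS.
Qed.

Lemma in_move T x y z : (z \in move_cell T x y) = (z == y) || (z != x) && (z \in T).
Proof. by rewrite /move_cell in_fset1U in_fsetD1. Qed.

Lemma repr_up pre A M B Q A' B' x T :
  repr (pre ++ A :: M ++ B :: Q) T -> col A' -> col B' ->
  (forall c, (c \in A') = (c == x) || (c \in A)) ->
  (forall c, (c \in B') = (c != x) && (c \in B)) ->
  repr (pre ++ A' :: M ++ B' :: Q)
       (move_cell T ((size pre + size M).+2, x) ((size pre).+1, x)).
Proof.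
move=> [+ h] cA' cB' hA hB; rewrite all_cat /= all_cat /= => /and5P[cp _ cM _ cQ].
split; first by rewrite all_cat /= all_cat /= cp cA' cM cB' cQ.
case=> [|i] c; rewrite in_move h !xpair_eqE //= !eqSS (@nth_two pre A A' M B B').
have jk : size pre == (size pre + size M).+1 = false by apply/eqP; nlia.
case: (i =P size pre) => [->|] /=; first by rewrite jk nth_fst hA.
by case: (i =P _) => [-> _|] //=; rewrite nth_snd hB.
Qed.

Lemma repr_down pre A M B Q A' B' x T :
  repr (pre ++ A :: M ++ B :: Q) T -> col A' -> col B' ->
  (forall c, (c \in A') = (c != x) && (c \in A)) ->
  (forall c, (c \in B') = (c == x) || (c \in B)) ->
  repr (pre ++ A' :: M ++ B' :: Q)
       (move_cell T ((size pre).+1, x) ((size pre + size M).+2, x)).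
Proof.
move=> [+ h] cA' cB' hA hB; rewrite all_cat /= all_cat /= => /and5P[cp _ cM _ cQ].
split; first by rewrite all_cat /= all_cat /= cp cA' cM cB' cQ.
case=> [|i] c; rewrite in_move h !xpair_eqE //= !eqSS (@nth_two pre A A' M B B').
have jk : size pre == (size pre + size M).+1 = false by apply/eqP; nlia.
case: (i =P size pre) => [->|] /=; first by rewrite jk nth_fst hA.
by case: (i =P _) => [-> _|] //=; rewrite nth_snd hB.
Qed.

Lemma split_nth (Ts : seq word) i c : c \in nth [::] Ts i ->
  Ts = take i Ts ++ nth [::] Ts i :: drop i.+1 Ts /\ size (take i Ts) = i.
Proof.
move=> ci; have iT : i < size Ts.
  by rewrite ltnNge; apply/negP => h; rewrite nth_default in ci.
by rewrite -drop_nth // cat_take_drop size_takel // ltnW.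
Qed.

Lemma mem_tail a R : col (a :: R) -> forall c, (c \in R) = (c != a) && (c \in a :: R).
Proof.
rewrite colE => /andP[aR _] c; rewrite inE; case: eqP => //= ->.
by apply/negP => /(allP aR) /=; rewrite ltnn.
Qed.

Lemma rmove_kohnert Ts Us T : repr Ts T -> rmove Ts Us ->
  exists2 U, kohnert_move T U & repr Us U.
Proof.
move=> rT [pre [s [M [a [R [Q [eT as_ aM ->]]]]]]]; rewrite {}eT in rT.
have [/[!all_cat] /= /[!all_cat] /= /and5P[cp cs cM caR cQ] h] := rT.
exists (move_cell T ((size pre + size M).+2, a) ((size pre).+1, a)).
  exists (size pre + size M).+2, (size pre).+1, a; split=> //.
  - split; first by rewrite h /= nth_snd mem_head.
    move=> c ac; rewrite h /= nth_snd inE negb_or; move: caR; rewrite colE => /andP[aR _].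
    apply/andP; split; first by apply/eqP; nlia.
    by apply/negP => /(allP aR) /=; nlia.
  - by rewrite /= ltnS ltnS leq_addr.
  - by rewrite h /= nth_fst.
  - case=> // t /andP[pt tM]; rewrite h /= nth_cat; rewrite !ltnS in pt tM.
    rewrite ltnNge (ltnW pt) /= -(subnSK pt) /= nth_cat.
    have -> : t - (size pre).+1 < size M by nlia.
    by apply: (allP aM); apply: mem_nth; nlia.
apply: repr_up rT _ _ _ _; first exact: col_ins.
- by move: caR; rewrite colE => /andP[].
- exact: mem_ins.
- exact: mem_tail.
Qed.

Lemma kohnert_rmove Ts T U : repr Ts T -> kohnert_move T U ->
  exists Us, [/\ rmove Ts Us, size Us = size Ts & repr Us U].
Proof.
move=> rT [r [s [c [[cT maxc] /andP[s0 sr] cs btw ->]]]].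
have [cTs h] := rT.
case: r sr cT maxc btw => // r; rewrite ltnS; case: s s0 cs => // s _ cs sr cT maxc btw.
rewrite h /= in cT; rewrite h /= in cs.
have [eT sz] := split_nth cT.
move: (nth _ _ _) (drop _ _) cT eT => A Q cA eT.
have st : s < size (take r Ts) by rewrite sz.
have eT2 : take r Ts = take s (take r Ts) ++ nth [::] Ts s :: drop s.+1 (take r Ts).
  by rewrite -(nth_take [::] sr) -drop_nth // cat_take_drop.
have szs : size (take s (take r Ts)) = s by rewrite size_takel // ltnW.
have szM : size (drop s.+1 (take r Ts)) = r - s.+1 by rewrite size_drop sz.
move: eT2 szs szM; move: (nth _ _ s) cs (take s _) (drop s.+1 _) => S cs pre M eT2 szs szM.
rewrite eT2 -catA /= in eT; have er : r = (size pre + size M).+1 by rewrite szs szM; nlia.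
have es : s = size pre by [].
clear eT2 st sz szs szM; subst r s; rewrite {}eT in rT cTs h *.
have := cTs; rewrite all_cat /= all_cat /= => /and5P[_ cS _ colA _].
have [R eA] : exists R, A = c :: R.
  apply: col_headE => //; apply/allP => x xA /=; rewrite leqNgt; apply/negP => /maxc.
  by rewrite h /= nth_snd xA.
subst A; exists (pre ++ ins c S :: M ++ R :: Q); split.
- exists pre, S, M, c, R, Q; split=> //; apply/(all_nthP [::]) => i iM.
  have := btw (size pre + i).+2; rewrite !ltnS leq_addr ltn_add2l iM => /(_ isT).
  rewrite h /= nth_cat ltnNge leqW ?leq_addr //= subSn ?leq_addr // addKn /=.
  by rewrite nth_cat iM.
- by rewrite !size_cat /= !size_cat.
- apply: repr_up rT _ _ _ _; first exact: col_ins.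
  + by move: colA; rewrite colE => /andP[].
  + exact: mem_ins.
  + exact: mem_tail.
Qed.

Lemma KD_acc Ds D T : nwrows Ds -> repr Ds D -> KD D T ->
  exists Ts, [/\ size Ts = size Ds, repr Ts T & acc Ds Ts [::]].
Proof.
move=> nwD rD DT; have {DT} := clos_rt_rtn1 _ _ _ _ (DT : clos_refl_trans _ _ D T).
elim=> [|U V UV _ [Us [sz rU aU]]]; first by exists Ds; split=> //; apply: acc_refl.
have [Vs [rm sV rV]] := kohnert_rmove rU UV.
exists Vs; split=> //; [by rewrite sV | apply: acc_rmove rm aU => //; by case: rU].
Qed.

Lemma acc_KD Ds D Ts T : nwrows Ds -> repr Ds D -> repr Ts T -> acc Ds Ts [::] -> KD D T.
Proof.
move=> nwD rD rT; have [cT _] := rT; move/(acc_rmoves nwD cT) => m; rewrite /KD /=.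
elim: m D rD rT {nwD cT} => {Ds Ts} [Ts|Ds Es Ts rm _ IH] D rD rT.
  by rewrite (repr_inj rD rT); apply: rt_refl.
have [U DU rU] := rmove_kohnert rD rm.
by apply: rt_trans (IH U rU rT); apply: rt_step.
Qed.

Definition row (T : cells) (i : nat) : word := sort geq [seq x.2 | x <- T & x.1 == i].

Definition rows (n : nat) (T : cells) : seq word := [seq row T i | i <- iota 1 n].

Lemma mem_row T i c : (c \in row T i) = ((i, c) \in T).
Proof.
rewrite mem_sort; apply/mapP/idP => [[[j d]]|h]; last by exists (i, c); rewrite ?mem_filter /= ?eqxx.
by rewrite mem_filter /= => /andP[/eqP -> ? ->].
Qed.

Lemma col_row T i : col (row T i).
Proof.
have u : uniq (row T i).
  rewrite sort_uniq map_inj_in_uniq ?filter_uniq ?fset_uniq // => -[j c] [k d].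
  by rewrite !mem_filter /= => /andP[/eqP -> _] /andP[/eqP -> _] ->.
have s : sorted geq (row T i) by apply: sort_sorted => x y /=; rewrite leq_total.
rewrite /col -sorted_pairwise; last exact: gtn_rev_trans.
move: u s.
case: (row T i) => //= a s; elim: s a => //= b s IH a /andP[].
rewrite inE negb_or => /andP[ab _] u /andP[ba h]; rewrite IH // andbT.
by rewrite ltn_neqAle eq_sym ab.
Qed.

Lemma nth_rows n T i : i < n -> nth [::] (rows n T) i = row T i.+1.
Proof. by move=> h; rewrite (nth_map 0) ?size_iota // nth_iota. Qed.

Lemma repr_rows n T : (forall x, x \in T -> 0 < x.1 <= n) -> repr (rows n T) T.
Proof.
move=> h; split; first by apply/allP => A /mapP[i _ ->]; exact: col_row.
case=> [|i] c; first by apply/negP => /h.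
have [lt|ge] := ltnP i n; first by rewrite nth_rows //= mem_row.
rewrite nth_default ?size_map ?size_iota //=.
by apply/negP => /h /=; rewrite ltnNge ge.
Qed.

Lemma nwrowsP Ds : all col Ds ->
  (forall i j k l, k \in nth [::] Ds j -> l \in nth [::] Ds i -> i < j -> k < l ->
     k \in nth [::] Ds i) -> nwrows Ds.
Proof.
elim: Ds => //= P Ds IH /andP[cP cD] h; rewrite cP IH //=; last first.
  by move=> i j k l; apply: (h i.+1 j.+1).
rewrite andbT; apply/allP => k /flattenP[A /(nthP [::])[j _ <-] kj].
rewrite /ok; case: (boolP (k \in P)) => //= kP; apply/allP => l lP /=.
rewrite ltnNge leq_eqVlt negb_or; apply/andP; split; last first.
  by apply: contra kP; apply: (h 0 j.+1).
by apply: contraNneq kP => ->.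
Qed.

Lemma repr_nwrows Ds D : repr Ds D -> northwest D -> nwrows Ds.
Proof.
move=> [cD h] nw; apply: nwrowsP => // i j k l kj li ij kl.
have := nw i.+1 j.+1 k l; rewrite !h /=; exact.
Qed.

Lemma count_repr Ts T i (p : pred nat) : repr Ts T -> 0 < i ->
  count (fun c : cell => (c.1 == i) && p c.2) T = count p (nth [::] Ts i.-1).
Proof.
move=> [cT h] i0.
have pr : perm_eq [seq c.2 | c <- T & c.1 == i] (nth [::] Ts i.-1).
  rewrite -(perm_sort geq); apply: uniq_perm.
  - exact/col_uniq/col_row.
  - have [lt|ge] := ltnP i.-1 (size Ts); last by rewrite nth_default.
    by apply/col_uniq/(allP cT)/mem_nth.
  - by move=> c; rewrite mem_row h i0.
rewrite -(permP pr) count_map count_filter; apply: eq_count => c /=.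
by rewrite andbC.
Qed.

Lemma KD_down D V r x : is_diagram D -> northwest D -> 0 < r ->
  (forall c, (r, c) \in D -> (r.+1, c) \in D) ->
  KD D V -> (r, x) \in V -> (r.+1, x) \notin V ->
  (forall y, count (fun c : cell => (c.1 == r) && (y <= c.2 < x)) V
          <= count (fun c : cell => (c.1 == r.+1) && (y <= c.2 < x)) V) ->
  KD D (move_cell V (r, x) (r.+1, x)).
Proof.
case: r => // r dD nwD _ below DV xV nxV le_count.
pose n := maxn r.+2 (\max_(c <- D) c.1).
have rD : repr (rows n D) D.
  apply: repr_rows => c cD; have [-> _] /= := dD c cD.
  rewrite leq_max; apply/orP; right.
  exact: (@leq_bigmax_seq _ (enum_fset D) xpredT (fun c : cell => c.1) c cD isT).
have nw := repr_nwrows rD nwD.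
have [Ts [sz rV aV]] := KD_acc nw rD DV.
have szn : size Ts = n by rewrite sz size_map size_iota.
have rn : r.+1 < n by rewrite leq_max leqnn.
have szD : size (rows n D) = n by rewrite size_map size_iota.
have [cTs h] := rV.
have eT : Ts = take r Ts ++ nth [::] Ts r :: nth [::] Ts r.+1 :: drop r.+2 Ts.
  by rewrite -!drop_nth ?szn ?(ltnW rn) // cat_take_drop.
have eD : rows n D = take r (rows n D) ++ row D r.+1 :: row D r.+2 :: drop r.+2 (rows n D).
  rewrite -(@nth_rows n D r (ltnW rn)) -(@nth_rows n D r.+1 rn).
  by rewrite -!drop_nth ?szD ?(ltnW rn) // cat_take_drop.
have xA : x \in nth [::] Ts r by have := xV; rewrite h.
have xB : x \notin nth [::] Ts r.+1 by have := nxV; rewrite h.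
have cA : col (nth [::] Ts r) by apply/(allP cTs)/mem_nth; rewrite szn ltnW.
have cB : col (nth [::] Ts r.+1) by apply/(allP cTs)/mem_nth; rewrite szn.
have le_c y : count (leq y) (lo x (nth [::] Ts r)) <= count (leq y) (lo x (nth [::] Ts r.+1)).
  have := le_count y; rewrite !count_filter.
  rewrite (@count_repr Ts V r.+1 (fun c => y <= c < x) rV) //.
  by rewrite (@count_repr Ts V r.+2 (fun c => y <= c < x) rV).
have szr : size (take r Ts) = r by rewrite size_takel // szn ltnW // ltnW.
set A := nth [::] Ts r in eT xA cA le_c; set B := nth [::] Ts r.+1 in eT xB cB le_c.
have l : lew (A ++ B) ((hi x A ++ lo x A) ++ ins x B).
  rewrite {1}(col_hi_mid_lo cA xA) {1}(col_hi_lo cB xB); apply: lew_knuth => //.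
    by rewrite colE all_lo col_filter.
  exact: col_ins.
pose Us := take r Ts ++ (hi x A ++ lo x A) :: [::] ++ ins x B :: drop r.+2 Ts.
apply: (@acc_KD (rows n D) D Us) => //.
  rewrite {1}eT in rV; have := @repr_down _ A [::] B _ (hi x A ++ lo x A) (ins x B) x _ rV.
  rewrite /= addn0 szr; apply.
  - apply: subseq_pairwise (cA); rewrite [X in subseq _ X](col_hi_mid_lo cA xA).
    by rewrite cat_subseq // subseq_cons.
  - exact: col_ins.
  - move=> c; rewrite mem_cat !memE; case: (ltngtP c x) => //= _; by rewrite ?orbF.
  - exact: mem_ins.
rewrite /Us; move: aV; rewrite {1}eT eD.
have : nwrows (take r (rows n D) ++ row D r.+1 :: row D r.+2 :: drop r.+2 (rows n D)) by rewrite -eD.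
have : size (take r (rows n D)) = size (take r Ts).
  by rewrite szr size_takel // size_map size_iota; nlia.
move: (take r (rows n D)) (take r Ts) [::] => pD pT; elim: pD pT => [|P pD IH] [|T pT] v //=.
  move=> _ nw'; apply: acc_pair => //; last exact: col_ins.
  by apply/allP => c; rewrite mem_row => /below; rewrite -mem_row.
by move=> [es] /and3P[_ _ nw'] /andP[-> /=]; apply: IH.
Qed.

(** * Pairings and crystal operators *)

Lemma count_sub (p : pred cell) (A B : cells) :
  (forall c, c \in A -> p c -> c \in B) -> count p A <= count p B.
Proof.
move=> h; rewrite -!size_filter; apply: uniq_leq_size; first by rewrite filter_uniq ?fset_uniq.
by move=> c; rewrite !mem_filter => /andP[pc cA]; rewrite pc /=; apply: h.
Qed.

Lemma count_fset1U (p : pred cell) x (A : cells) :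
  x \notin A -> count p (x |` A) = (p x + count p A)%N.
Proof.
move=> xA; suff /permP -> : perm_eq (x |` A) (x :: A) by [].
apply: uniq_perm; rewrite ?fset_uniq //= ?xA ?fset_uniq // => c.
exact: in_fset1U.
Qed.

Definition between (r y x : nat) : pred cell := fun c => (c.1 == r) && (y <= c.2 < x).

Definition balanced (T : cells) (r : nat) (P : cells) : Prop :=
  (P `<=` T)%fset /\
  forall x, x \in T -> x.1 \in [:: r; r.+1] -> x \notin P ->
    (forall c, c \in P -> c.2 != x.2) /\
    (forall y, count (between r y x.2) P <= count (between r.+1 y x.2) P).

Lemma pair_step_cases T r P : (pair_step T r P = P /\
    forall u v, u \in T -> v \in T -> pairable T r P (u, v) = false) \/
  exists u v, [/\ u \in T, v \in T, pairable T r P (u, v) & pair_step T r P = u |` (v |` P)].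
Proof.
rewrite /pair_step; set s := filter _ _.
have mem_s u v : ((u, v) \in s) = [&& pairable T r P (u, v), u \in T & v \in T].
  rewrite mem_filter; congr (_ && _); apply/allpairsP/andP => [[[u' v'] /= [? ? [-> ->]]]//|[uT vT]].
  by exists (u, v).
case: s mem_s => [|[u v] s] mem_s /=; last first.
  by right; exists u, v; have := mem_s u v; rewrite mem_head => /esym/and3P[].
by left; split=> // u v uT vT; have := mem_s u v; rewrite uT vT !andbT => /esym.
Qed.

Lemma pairableP T r P u v : pairable T r P (u, v) ->
  [/\ u.1 = r, v.1 = r.+1, u \notin P, v \notin P & u.2 <= v.2] /\
  forall x, x \in T -> x.1 \in [:: r; r.+1] -> u.2 <= x.2 <= v.2 -> x \notin P ->
    x \in [:: u; v].
Proof.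
case/and5P=> /eqP ur /eqP vr uP vP /andP[uv /allP h]; split=> // x xT xr xuv xP.
by have := h x xT; rewrite xr xuv (negPf xP).
Qed.

Lemma balanced_step T r P : balanced T r P -> balanced T r (pair_step T r P).
Proof.
case: (pair_step_cases T r P) => [[-> _]//|[u [v [uT vT pr ->]]]] [PT bal].
have [[ur vr uP vP uv] between_uv] := pairableP pr.
split; first by rewrite !fsubUset !fsub1set uT vT.
have uvP : u \notin v |` P.
  by rewrite in_fset1U (negPf uP) orbF; apply/eqP => e; move: vr; rewrite -e ur; nlia.
move=> x xT xr; rewrite !in_fset1U !negb_or => /and3P[xu xv xP].
have [colx le_count] := bal x xT xr xP.
have nuv : ~~ (u.2 <= x.2 <= v.2).
  apply/negP => h; have := between_uv x xT xr h xP.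
  by rewrite !inE (negPf xu) (negPf xv).
split=> [c|y].
  rewrite !in_fset1U => /or3P[/eqP->|/eqP->|/colx //];
  by apply: contraNneq nuv => e; rewrite -e leqnn uv.
rewrite !count_fset1U // /between ur vr !eqxx /=.
have -> : r.+1 == r = false by apply/eqP; nlia.
have -> : r == r.+1 = false by apply/eqP; nlia.
move: nuv (le_count y); rewrite /between; nlia.
Qed.

Lemma paired_balanced T r : balanced T r (paired T r).
Proof.
rewrite /paired; elim: #|` T| => [|k IH] /=; last exact: balanced_step.
by split=> [|x _ _ _]; [exact: fsub0set | split=> // c; rewrite in_fset0].
Qed.

Lemma paired_maximal T r u v : u \in T -> v \in T -> pairable T r (paired T r) (u, v) = false.
Proof.
have step k : (k <= #|` iter k (pair_step T r) fset0|) \/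
    forall u v, u \in T -> v \in T -> pairable T r (iter k (pair_step T r) fset0) (u, v) = false.
  elim: k => [|k IH] /=; first by left.
  case: (pair_step_cases T r (iter k (pair_step T r) fset0)) => [[-> h]|]; first by right.
  move=> [u' [v' [u'T v'T pr ->]]]; left; case: IH => [IH|h]; last by rewrite h in pr.
  have [[ur vr uP vP _] _] := pairableP pr.
  rewrite !cardfsU1 in_fset1U (negPf uP) (negPf vP) orbF.
  have -> : u' == v' = false by apply/eqP => e; move: vr; rewrite -e ur; nlia.
  by rewrite /=; nlia.
move=> uT vT; case: (step #|` T|) => [le_card|]; last exact.
have [PT _] := paired_balanced T r.
have /eqP eP : paired T r == T by rewrite eqEfcard PT.
by apply/negP => /pairableP[[_ _ + _ _] _]; rewrite eP uT.
Qed.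

(* A free cell of row [r] weakly to the left of a free cell of row [r.+1] would
   give rise to a pairable pair: take a nearest pair of this kind. *)
Lemma unpaired_noncrossing (T : cells) (r a b : nat) : (r, a) \in T -> (r, a) \notin paired T r ->
  (r.+1, b) \in T -> (r.+1, b) \notin paired T r -> b < a.
Proof.
move=> aT aP bT bP; rewrite ltnNge; apply/negP => ab.
pose free s c := ((s, c) \in T) && ((s, c) \notin paired T r).
have exa : exists c, free r c && (c <= b) by exists a; rewrite /free aT aP.
have [] := @ex_maxnP (fun c => free r c && (c <= b)) b exa; first by move=> c /andP[].
move=> a' /andP[/andP[a'T a'P] a'b] maxa.
have exb : exists c, free r.+1 c && (a' <= c) by exists b; rewrite /free bT bP.
have [b' /andP[/andP[b'T b'P] a'b'] minb] := ex_minnP exb.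
have b'b : b' <= b by apply: minb; rewrite /free bT bP.
have := paired_maximal r a'T b'T; rewrite /pairable /= !eqxx a'P b'P a'b' /=.
move/negP; apply; apply/allP => -[s c] cT /=; apply/implyP.
rewrite !inE => /andP[sr /andP[ac cb]]; case: (boolP ((s, c) \in _)) => //= cP.
case/orP: sr => /eqP es; subst s; rewrite !xpair_eqE !eqxx /=.
  have := maxa c; rewrite /free cT cP /= => /(_ (leq_trans cb b'b)) ca.
  by rewrite eqn_leq ca ac.
have := minb c; rewrite /free cT cP /= => /(_ ac) bc.
by rewrite [c == b']eqn_leq cb bc orbT.
Qed.

Lemma unpairedP (T : cells) (r s c : nat) l : unpaired_cols T r s = l -> c \in l ->
  (s, c) \in T /\ (s, c) \notin paired T r.
Proof.
move=> <-; rewrite mem_sort => /mapP[[s' c'] + ->] /=.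
by rewrite mem_filter /= => /andP[/andP[/eqP -> ?] ?].
Qed.

Lemma unpaired_count (T : cells) (r s x : nat) : s \in [:: r; r.+1] -> (s, x) \in T ->
  (s, x) \notin paired T r ->
  (forall c, c < x -> (r, c) \in T -> (r, c) \in paired T r) ->
  forall y, count (between r y x) T <= count (between r.+1 y x) T.
Proof.
move=> sr xT xP left_paired y; have [PT bal] := paired_balanced T r.
have [_ /(_ y) /= le_count] := bal _ xT sr xP.
apply: leq_trans (leq_trans le_count _).
  apply: count_sub => -[t c] cT /andP[/= /eqP et /andP[_ cx]].
  by rewrite et; apply: left_paired => //; rewrite -et.
by apply: count_sub => c /(fsubsetP PT).
Qed.

Lemma unpaired_col (T : cells) (r s x : nat) : s \in [:: r; r.+1] -> (s, x) \in T ->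
  (s, x) \notin paired T r -> forall t, (t, x) \notin paired T r.
Proof.
move=> sr xT xP t; have [_ bal] := paired_balanced T r.
have [h _] := bal _ xT sr xP; apply/negP => /h /=; by rewrite eqxx.
Qed.

Lemma KD_lowering D r T U : is_diagram D -> northwest D -> 0 < r ->
  (forall c, (r, c) \in D -> (r.+1, c) \in D) ->
  KD D T -> lowering r T = Some U -> KD D U.
Proof.
move=> dD nwD r0 below DT; rewrite /lowering.
case e : (unpaired_cols T r r) => [|x l] // [<-].
have [xT xP] := unpairedP e (mem_head x l).
have rr : r \in [:: r; r.+1] by rewrite mem_head.
have xmin c : (r, c) \in T -> (r, c) \notin paired T r -> x <= c.
  move=> cT cP; have : c \in x :: l.
    rewrite -e mem_sort; apply/mapP; exists (r, c) => //.
    by rewrite mem_filter /= eqxx cP.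
  rewrite inE => /orP[/eqP -> //|cl].
  have : sorted leq (x :: l) by rewrite -e; apply: sort_sorted => ? ?; exact: leq_total.
  by move=> /(order_path_min leq_trans) /allP; apply.
apply: KD_down => //.
  apply/negP => x1T; have := unpaired_noncrossing xT xP x1T (unpaired_col rr xT xP _).
  by rewrite ltnn.
apply: (unpaired_count rr xT xP) => c cx cT; apply: contraTT cx => cP.
by rewrite -leqNgt; apply: xmin.
Qed.

Lemma KD_raising D r T U : is_diagram D -> northwest D -> 0 < r ->
  (forall c, (r, c) \in D -> (r.+1, c) \in D) ->
  raising r T = Some U -> KD D U -> KD D T.
Proof.
move=> dD nwD r0 below; rewrite /raising.
case e : (unpaired_cols T r r.+1) => [|x0 l] // [].
have [] := unpairedP e (mem_last x0 l); move: (last x0 l) => x xT xP eU DU.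
have rr : r.+1 \in [:: r; r.+1] by rewrite !inE eqxx orbT.
have nrr : (r.+1 == r) = false by apply/eqP; nlia.
have nx : (r, x) \notin T.
  apply/negP => rT; have := unpaired_noncrossing rT (unpaired_col rr xT xP _) xT xP.
  by rewrite ltnn.
have eT : T = move_cell U (r, x) (r.+1, x).
  apply/fsetP => -[s c]; rewrite in_move -eU in_move !xpair_eqE.
  have [->|_] /= := eqVneq c x; last by rewrite !andbF.
  rewrite !andbT; have [->|sr1] /= := eqVneq s r.+1; first by rewrite xT.
  by have [->|_] /= := eqVneq s r; first exact: negPf.
rewrite eT; apply: KD_down => //.
- by rewrite -eU in_move eqxx.
- by rewrite -eU in_move eqxx xpair_eqE nrr.
move=> y; have le_count : count (between r y x) T <= count (between r.+1 y x) T.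
  apply: (unpaired_count rr xT xP) => c cx cT; apply: contraTT cx => cP.
  by rewrite -leqNgt; apply: ltnW; apply: unpaired_noncrossing cP xT xP.
apply: leq_trans (leq_trans le_count _).
  apply: count_sub => -[s c]; rewrite -eU in_move !xpair_eqE /= => + /and3P[_ _ cx].
  by rewrite (ltn_eqF cx) andbF => /andP[].
apply: count_sub => -[s c] cT /and3P[_ _ /= cx].
by rewrite -eU in_move !xpair_eqE cT (ltn_eqF cx) !andbF.
Qed.

Lemma KD_diagram D T : is_diagram D -> KD D T -> is_diagram T.
Proof.
move=> dD DT; elim: {DT}(DT : clos_refl_trans _ _ D T) dD => {D T} //; last first.
  by move=> T U V _ IH _ IH' /IH /IH'.
move=> T U [r [s [c [[cT _] /andP[s0 _] _ _ ->]]]] dT x.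
by rewrite in_move => /orP[/eqP ->|/andP[_ /dT //]]; have [] := dT _ cT.
Qed.

Theorem theorem4p11 (D : cells) (r : nat)
  (diagD : is_diagram D) (nwD : northwest D) (r_gt0 : 0 < r)
  (belowD : forall c : nat, (r, c) \in D -> (r.+1, c) \in D) :
  (forall T U : cells, KD D T -> lowering r T = Some U -> KD D U) /\
  frakD r (KD D) = KD D.
Proof.
split; first by move=> T U; apply: KD_lowering.
apply/seteqP; split=> [U [_ [k [V eV DV]]]|U DU]; last first.
  by split; [apply: KD_diagram DU | exists 0, U].
elim: k U eV => [|k IH] U; first by move=> [->].
rewrite iterSr /=; case e : (raising r U) => [W|] /=; last first.
  suff -> : iter k (obind (raising r)) None = None by [].
  by elim: (k) => //= n ->.
by move/IH; apply: KD_raising e.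
Qed.
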